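(* Let $\pi$ be a $\mathsf{QMLL}$ proof of $\vdash A$ and let $N$ be a negative context for $A$. Then the map $[\![\pi]\!]_N:\mathbb C^{2^{d(N)}}\to\mathbb C^{2^{d(N)}}$, defined by $[\![\pi]\!]_N(Q)=R$ iff $(A,N,\varepsilon,Q)\to_\pi^*(A,P,\varepsilon,R)$ for some positive context $P$ for $A$, is a unitary operator. Moreover, a quantum circuit computing it can be effectively extracted from $\pi$ and $N$.
   Context: $\mathsf{QMLL}$ formulas: $A ::= \alpha \mid \alpha^\perp \mid A\wp A \mid A\otimes A \mid \boxdot A \mid \Diamond A$ ($\alpha$ atoms; $\wp$ = par, $\otimes$ = tensor; $\boxdot,\Diamond$ dual modalities); negation: $(\alpha^\perp)^\perp=\alpha$, $(A\otimes B)^\perp=A^\perp\wp B^\perp$, $(A\wp B)^\perp=A^\perp\otimes B^\perp$, $(\boxdot A)^\perp=\Diamond A^\perp$, $(\Diamond A)^\perp=\boxdot A^\perp$; $\boxdot^nA,\Diamond^nA$ are $n$-fold prefixes; modal formulas are those of the form $\boxdot A$ or $\Diamond A$. $\mathcal U_n$ = unitary operators on $\mathbb C^{2^n}$. Rules: axiom $\vdash A^\perp,A$; cut: from $\vdash\Gamma,A$, $\vdash\Delta,A^\perp$ infer $\vdash\Gamma,\Delta$; par: from $\vdash\Gamma,A,B$ infer $\vdash\Gamma,A\wp B$; tensor: from $\vdash\Gamma,A$, $\vdash\Delta,B$ infer $\vdash\Gamma,\Delta,A\otimes B$; quantum rule $\mathsf{Q}_n$ labelled by $U\in\mathcal U_n$: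 from $\vdash A,B$ infer $\vdash\Diamond^nA,\boxdot^nB$, provided $A,B$ both modal or both non-modal. Proofs are finite trees of rule instances; formulas in them are considered as occurrences. A context is a formula with one hole: $C ::= [\cdot] \mid C\wp A \mid A\wp C \mid C\otimes A \mid A\otimes C \mid \boxdot C \mid \Diamond C$; $C[A]$ fills the hole with $A$. $C$ is positive (resp. negative) for $A$ if $A=C[\alpha]$ (resp. $A=C[\alpha^\perp]$) for an atom $\alpha$; $P$, $N$ denote positive, negative contexts. $C^\perp$ is the De Morgan dual context (e.g. $(A\otimes C)^\perp=A^\perp\wp C^\perp$, $(\boxdot C)^\perp=\Diamond C^\perp$). $d(C)$ (nesting depth) is the number of modal operators enclosing the hole. A stack is a finite word over $\{\boxdot,\Diamond\}$, $|s|$ its length, $\varepsilon$ the empty stack. A state of $\pi$ is $(A,C,s,Q)$ with $A$ a formula occurrence in $\pi$, $C$ a context for $A$, $s$ a stack, $Q$ a quantum register of $d(C)+|s|$ qubits, i.e. a unit vector in $\mathbb C^{2^{d(C)+|s|}}$. Transitions $\to_\pi$, defined per rule instance (subscripts 2/1 mark a context formula's occurrence in a premise/the conclusion): Axiom $\vdash A^\perp,A$: $(A,N,s,Q)\to(A^\perp,N^\perp,s,Q)$, $(A^\perp,N,s,Q)\to(A,N^\perp,s,Q)$. Cut on $A$/$A^\perp$: $(A,P,s,Q)\to(A^\perp,P^\perp,s,Q)$, $(A^\perp,P,s,Q)\to(A,P^\perp,s,Q)$; context formulas: $(X_1,N,s,Q)\to(X_2,N,s,Q)$, $(X_2,P,s,Q)\to(X_1,P,s,Q)$.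 Par/tensor introducing $A\star B$ ($\star\in\{\wp,\otimes\}$): $(A\star B,N\star B,s,Q)\to(A,N,s,Q)$, $(A\star B,A\star N,s,Q)\to(B,N,s,Q)$, $(A,P,s,Q)\to(A\star B,P\star B,s,Q)$, $(B,P,s,Q)\to(A\star B,A\star P,s,Q)$; context formulas pass as for cut. $\mathsf{Q}_n$ with label $U$, premise $\vdash A,B$, conclusion $\vdash\Diamond^nA,\boxdot^nB$: $(\Diamond^nA,\Diamond^nN,s,Q)\to(A,N,s\cdot\Diamond^n,Q)$; $(\boxdot^nB,\boxdot^nN,s,Q)\to(B,N,s\cdot\boxdot^n,Q)$; $(A,P,s\cdot\Diamond^n,Q)\to(\Diamond^nA,\Diamond^nP,s,Q)$; $(A,P,s\cdot\boxdot^n,Q)\to(\Diamond^nA,\Diamond^nP,s,(I_{d(P)}\otimes U^*\otimes I_{|s|})(Q))$; $(B,P,s\cdot\boxdot^n,Q)\to(\boxdot^nB,\boxdot^nP,s,Q)$; $(B,P,s\cdot\Diamond^n,Q)\to(\boxdot^nB,\boxdot^nP,s,(I_{d(P)}\otimes U\otimes I_{|s|})(Q))$, where $I_k$ is the identity on $\mathbb C^{2^k}$ and $U^*$ the adjoint. $\to_\pi^*$ is the reflexive-transitive closure of $\to_\pi$.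
   Formalization: The quantum rule Q_n is taken only for n ≥ 1: for n = 0 the stacks s·□^n and s·◇^n coincide, both exit transitions apply, and a phase label U ≠ 1 makes the map multi-valued. *)

(* Defs.v *)
From Stdlib Require Export Relation_Operators.
From HB Require Import structures.
From mathcomp Require Export all_boot all_order all_algebra.
From mathcomp Require Export spectral reals complex.
From mathcomp Require mxtens.

Set Implicit Arguments.
Unset Strict Implicit.
Unset Printing Implicit Defensive.

Export GRing.Theory Num.Theory.
Local Open Scope ring_scope.

Local Notation "A *t B" := (mxtens.tensmx A B) (at level 40, left associativity).

(** * Formulas and contexts *)

Inductive formula : Type :=
| Atom of nat
| NAtom of nat
| Par of formula & formula
| Tens of formula & formula
| Box of formula
| Dia of formula.

Fixpoint dual (A : formula) : formula :=
  match A with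
  | Atom a => NAtom a
  | NAtom a => Atom a
  | Par B C => Tens (dual B) (dual C)
  | Tens B C => Par (dual B) (dual C)
  | Box B => Dia (dual B)
  | Dia B => Box (dual B)
  end.

Definition is_modal (A : formula) : bool :=
  match A with Box _ | Dia _ => true | _ => false end.

Inductive ctx : Type :=
| Hole
| CParL of ctx & formula
| CParR of formula & ctx
| CTensL of ctx & formula
| CTensR of formula & ctx
| CBox of ctx
| CDia of ctx.

Fixpoint fill (C : ctx) (X : formula) : formula :=
  match C with
  | Hole => X
  | CParL D A => Par (fill D X) A
  | CParR A D => Par A (fill D X)
  | CTensL D A => Tens (fill D X) A
  | CTensR A D => Tens A (fill D X)
  | CBox D => Box (fill D X)
  | CDia D => Dia (fill D X)
  end.

Definition context_for (C : ctx) (A : formula) : Prop := exists X, A = fill C X.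
Definition positive (C : ctx) (A : formula) : Prop := exists a, A = fill C (Atom a).
Definition negative (C : ctx) (A : formula) : Prop := exists a, A = fill C (NAtom a).

Fixpoint cdual (C : ctx) : ctx :=
  match C with
  | Hole => Hole
  | CParL D A => CTensL (cdual D) (dual A)
  | CParR A D => CTensR (dual A) (cdual D)
  | CTensL D A => CParL (cdual D) (dual A)
  | CTensR A D => CParR (dual A) (cdual D)
  | CBox D => CDia (cdual D)
  | CDia D => CBox (cdual D)
  end.

Fixpoint depth (C : ctx) : nat :=
  match C with
  | Hole => 0
  | CParL D _ | CParR _ D | CTensL D _ | CTensR _ D => depth D
  | CBox D | CDia D => (depth D).+1
  end.

(** * Proofs *)

(** Sequents are lists whose principal formulas stand at the head; [PExch] is
    the exchange left implicit when sequents are read as multisets of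
    occurrences.  [PQ] requires [0 < n]: for [n = 0] the words [s . Box^n] and
    [s . Dia^n] coincide, the transitions of the rule overlap, and a run has
    several results as soon as the label is a phase other than 1. *)
Inductive proof (R : realType) : seq formula -> Type :=
| PAx A : proof R [:: dual A; A]
| PCut A Gamma Delta :
    proof R (A :: Gamma) -> proof R (dual A :: Delta) -> proof R (Gamma ++ Delta)
| PPar A B Gamma :
    proof R [:: A, B & Gamma] -> proof R (Par A B :: Gamma)
| PTens A B Gamma Delta :
    proof R (A :: Gamma) -> proof R (B :: Delta) ->
    proof R (Tens A B :: Gamma ++ Delta)
| PQ n A B (U : 'M[R[i]]_(2 ^ n)) :
    (0 < n)%N -> U \is unitarymx -> is_modal A = is_modal B ->
    proof R [:: A; B] -> proof R [:: iter n Dia A; iter n Box B]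
| PExch Gamma A B Delta :
    proof R (Gamma ++ [:: A, B & Delta]) -> proof R (Gamma ++ [:: B, A & Delta]).

Arguments PAx {R} A.
Arguments PCut {R} A Gamma Delta p q.
Arguments PPar {R} A B Gamma p.
Arguments PTens {R} A B Gamma Delta p q.
Arguments PQ {R} n A B U n_gt0 U_unitary mAB p.
Arguments PExch {R} Gamma A B Delta p.

(** A rule instance is addressed by the path leading to it from the root:
    [false] selects the first (or only) premise, [true] the second. *)
Definition address := seq bool.

Fixpoint subproof (R : realType) (Gamma : seq formula) (p : proof R Gamma)
    (a : address) {struct p} : option {Delta : seq formula & proof R Delta} :=
  match a with
  | [::] => Some (existT _ Gamma p)
  | b :: a' =>
    match p with
    | PAx _ => None
    | PCut _ _ _ q r => if b then subproof r a' else subproof q a'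
    | PPar _ _ _ q => if b then None else subproof q a'
    | PTens _ _ _ _ q r => if b then subproof r a' else subproof q a'
    | PQ _ _ _ _ _ _ _ q => if b then None else subproof q a'
    | PExch _ _ _ _ q => if b then None else subproof q a'
    end
  end.

(** [(a, j)] is the [j]-th formula of the conclusion of the rule instance at
    [a]; the formulas of its premises are thus [(rcons a b, i)]. *)
Definition occurrence := (address * nat)%type.

Definition formula_at (R : realType) (Gamma : seq formula) (p : proof R Gamma)
    (o : occurrence) : option formula :=
  if subproof p o.1 is Some (existT Delta _) then onth Delta o.2 else None.

Definition exch_index (k i : nat) : nat :=
  if i == k then k.+1 else if i == k.+1 then k else i.

(** [context_formula p X b i j]: in the last rule of [p], the context formula
    [X] occurs at index [i] of premise [b] and at index [j] of the conclusion. *)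
Inductive context_formula (R : realType) :
    forall Gamma, proof R Gamma -> formula -> bool -> nat -> nat -> Prop :=
| CFCutL A Gamma Delta p q X i : onth Gamma i = Some X ->
    context_formula (PCut A Gamma Delta p q) X false i.+1 i
| CFCutR A Gamma Delta p q X i : onth Delta i = Some X ->
    context_formula (PCut A Gamma Delta p q) X true i.+1 (size Gamma + i)
| CFPar A B Gamma p X i : onth Gamma i = Some X ->
    context_formula (PPar A B Gamma p) X false i.+2 i.+1
| CFTensL A B Gamma Delta p q X i : onth Gamma i = Some X ->
    context_formula (PTens A B Gamma Delta p q) X false i.+1 i.+1
| CFTensR A B Gamma Delta p q X i : onth Delta i = Some X ->
    context_formula (PTens A B Gamma Delta p q) X true i.+1 (size Gamma + i).+1
| CFExch Gamma A B Delta p X i :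
    onth (Gamma ++ [:: A, B & Delta]) i = Some X ->
    context_formula (PExch Gamma A B Delta p) X false i (exch_index (size Gamma) i).

(** * Quantum registers *)

Lemma expn2_split d n k m :
  (d + n + k = m)%N -> (2 ^ d * 2 ^ n * 2 ^ k = 2 ^ m)%N.
Proof. by move=> <-; rewrite !expnD. Qed.

Definition on_qubits (R : realType) (d n k m : nat) (e : (d + n + k = m)%N)
    (U : 'M[R[i]]_(2 ^ n)) : 'M[R[i]]_(2 ^ m) :=
  castmx (expn2_split e, expn2_split e)
    ((1%:M : 'M_(2 ^ d)) *t U *t (1%:M : 'M_(2 ^ k))).

Definition adjoint (R : realType) (n : nat) (U : 'M[R[i]]_n) : 'M[R[i]]_n :=
  map_mx Num.conj U^T.

Definition unit_vector (R : realType) (n : nat) (Q : 'cV[R[i]]_n) : Prop :=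
  \sum_(i < n) `|Q i 0| ^+ 2 = 1.

(** * The token machine *)

Inductive modality := MBox | MDia.

(** The right end of the word is its top. *)
Definition stack := seq modality.

(** The number of qubits [m], constant along transitions, is an index; that it
    equals [d(C) + |s|] is part of [is_state]. *)
Record config (R : realType) (m : nat) := Config {
  c_occ : occurrence;
  c_ctx : ctx;
  c_stack : stack;
  c_reg : 'cV[R[i]]_(2 ^ m)
}.

Arguments Config {R m} c_occ c_ctx c_stack c_reg.

Definition is_state (R : realType) (m : nat) (Gamma : seq formula)
    (pi : proof R Gamma) (x : config R m) : Prop :=
  [/\ exists2 A, formula_at pi (c_occ x) = Some A & context_for (c_ctx x) A,
      (depth (c_ctx x) + size (c_stack x) = m)%N
    & unit_vector (c_reg x)].

(** Transitions of the last rule of a subproof, [a] being its address. *)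
Inductive rule_step (R : realType) (m : nat) (a : address) :
    forall Gamma, proof R Gamma -> config R m -> config R m -> Prop :=
| AxR A N s Q : negative N A ->
    rule_step a (PAx A)
      (Config (a, 1) N s Q) (Config (a, 0) (cdual N) s Q)
| AxL A N s Q : negative N (dual A) ->
    rule_step a (PAx A)
      (Config (a, 0) N s Q) (Config (a, 1) (cdual N) s Q)
| CutL A Gamma Delta p q P s Q : positive P A ->
    rule_step a (PCut A Gamma Delta p q)
      (Config (rcons a false, 0) P s Q) (Config (rcons a true, 0) (cdual P) s Q)
| CutR A Gamma Delta p q P s Q : positive P (dual A) ->
    rule_step a (PCut A Gamma Delta p q)
      (Config (rcons a true, 0) P s Q) (Config (rcons a false, 0) (cdual P) s Q)
| ContextUp Gamma (p : proof R Gamma) X b i j N s Q :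
    context_formula p X b i j -> negative N X ->
    rule_step a p (Config (a, j) N s Q) (Config (rcons a b, i) N s Q)
| ContextDown Gamma (p : proof R Gamma) X b i j P s Q :
    context_formula p X b i j -> positive P X ->
    rule_step a p (Config (rcons a b, i) P s Q) (Config (a, j) P s Q)
| ParUpL A B Gamma p N s Q : negative N A ->
    rule_step a (PPar A B Gamma p)
      (Config (a, 0) (CParL N B) s Q) (Config (rcons a false, 0) N s Q)
| ParUpR A B Gamma p N s Q : negative N B ->
    rule_step a (PPar A B Gamma p)
      (Config (a, 0) (CParR A N) s Q) (Config (rcons a false, 1) N s Q)
| ParDownL A B Gamma p P s Q : positive P A ->
    rule_step a (PPar A B Gamma p)
      (Config (rcons a false, 0) P s Q) (Config (a, 0) (CParL P B) s Q)
| ParDownR A B Gamma p P s Q : positive P B ->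
    rule_step a (PPar A B Gamma p)
      (Config (rcons a false, 1) P s Q) (Config (a, 0) (CParR A P) s Q)
| TensUpL A B Gamma Delta p q N s Q : negative N A ->
    rule_step a (PTens A B Gamma Delta p q)
      (Config (a, 0) (CTensL N B) s Q) (Config (rcons a false, 0) N s Q)
| TensUpR A B Gamma Delta p q N s Q : negative N B ->
    rule_step a (PTens A B Gamma Delta p q)
      (Config (a, 0) (CTensR A N) s Q) (Config (rcons a true, 0) N s Q)
| TensDownL A B Gamma Delta p q P s Q : positive P A ->
    rule_step a (PTens A B Gamma Delta p q)
      (Config (rcons a false, 0) P s Q) (Config (a, 0) (CTensL P B) s Q)
| TensDownR A B Gamma Delta p q P s Q : positive P B ->
    rule_step a (PTens A B Gamma Delta p q)
      (Config (rcons a true, 0) P s Q) (Config (a, 0) (CTensR A P) s Q)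
| QUpDia n A B U n_gt0 U_unitary mAB p N s Q : negative N A ->
    rule_step a (PQ n A B U n_gt0 U_unitary mAB p)
      (Config (a, 0) (iter n CDia N) s Q)
      (Config (rcons a false, 0) N (s ++ nseq n MDia) Q)
| QUpBox n A B U n_gt0 U_unitary mAB p N s Q : negative N B ->
    rule_step a (PQ n A B U n_gt0 U_unitary mAB p)
      (Config (a, 1) (iter n CBox N) s Q)
      (Config (rcons a false, 1) N (s ++ nseq n MBox) Q)
| QDownDiaDia n A B U n_gt0 U_unitary mAB p P s Q : positive P A ->
    rule_step a (PQ n A B U n_gt0 U_unitary mAB p)
      (Config (rcons a false, 0) P (s ++ nseq n MDia) Q)
      (Config (a, 0) (iter n CDia P) s Q)
| QDownBoxDia n A B U n_gt0 U_unitary mAB p P s Q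
    (e : (depth P + n + size s = m)%N) : positive P A ->
    rule_step a (PQ n A B U n_gt0 U_unitary mAB p)
      (Config (rcons a false, 0) P (s ++ nseq n MBox) Q)
      (Config (a, 0) (iter n CDia P) s (on_qubits e (adjoint U) *m Q))
| QDownBoxBox n A B U n_gt0 U_unitary mAB p P s Q : positive P B ->
    rule_step a (PQ n A B U n_gt0 U_unitary mAB p)
      (Config (rcons a false, 1) P (s ++ nseq n MBox) Q)
      (Config (a, 1) (iter n CBox P) s Q)
| QDownDiaBox n A B U n_gt0 U_unitary mAB p P s Q
    (e : (depth P + n + size s = m)%N) : positive P B ->
    rule_step a (PQ n A B U n_gt0 U_unitary mAB p)
      (Config (rcons a false, 1) P (s ++ nseq n MDia) Q)
      (Config (a, 1) (iter n CBox P) s (on_qubits e U *m Q)).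

Definition step (R : realType) (m : nat) (Gamma : seq formula)
    (pi : proof R Gamma) (x y : config R m) : Prop :=
  [/\ is_state pi x, is_state pi y
    & exists a Delta (p : proof R Delta),
        subproof pi a = Some (existT _ Delta p) /\ rule_step a p x y].

(** The graph of the interpretation of [pi] at [N]. *)
Definition interp (R : realType) (A : formula) (pi : proof R [:: A]) (N : ctx)
    (Q Q' : 'cV[R[i]]_(2 ^ depth N)) : Prop :=
  exists2 P, positive P A &
    clos_refl_trans _ (step pi)
      (Config ([::], 0) N [::] Q) (Config ([::], 0) P [::] Q').

Arguments interp {R A} pi N Q Q'.

(** Registers being unit vectors, the interpretation is identified with the
    linear operator [M] of which it is the restriction to the unit sphere. *)
Definition denotes (R : realType) (A : formula) (pi : proof R [:: A]) (N : ctx)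
    (M : 'M[R[i]]_(2 ^ depth N)) : Prop :=
  forall Q, unit_vector Q -> forall Q', interp pi N Q Q' <-> Q' = M *m Q.

Arguments denotes {R A} pi N M.

(** * Circuits over the labels of a proof *)

(** A gate is the label [U] of the quantum rule at address [g_rule], or its
    adjoint, applied to the consecutive wires starting at [g_wire]. *)
Record gate := Gate { g_rule : address; g_adjoint : bool; g_wire : nat }.

(** The gate at the head is applied first. *)
Definition circuit := seq gate.

Inductive gate_computes (R : realType) (Gamma : seq formula) (pi : proof R Gamma)
    (m : nat) : gate -> 'M[R[i]]_(2 ^ m) -> Prop :=
| GateComputes a (adj : bool) d n k (e : (d + n + k = m)%N)
    A B U n_gt0 U_unitary mAB p :
    subproof pi a = Some (existT _ _ (PQ n A B U n_gt0 U_unitary mAB p)) ->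
    gate_computes pi (Gate a adj d) (on_qubits e (if adj then adjoint U else U)).

Inductive circuit_computes (R : realType) (Gamma : seq formula)
    (pi : proof R Gamma) (m : nat) : circuit -> 'M[R[i]]_(2 ^ m) -> Prop :=
| CircuitNil : circuit_computes pi [::] 1%:M
| CircuitCons g c G M :
    gate_computes pi g G -> circuit_computes pi c M ->
    circuit_computes pi (g :: c) (M *m G).

(** * Effectivity *)

(** Computable functions are those defined by first-order recursive programs
    over binary trees: a program is a list of unary function bodies, [TArg] is
    the argument of the current function and [TCall k t] calls the [k]-th one. *)
Inductive data := Leaf | Node of data & data.

Inductive term :=
| TArg
| TLeaf
| TNode of term & term
| THd of term
| TTl of term
| TIf of term & term & term
| TCall of nat & term.

Definition program := seq term.

Definition data_hd (v : data) : data := if v is Node u _ then u else Leaf.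
Definition data_tl (v : data) : data := if v is Node _ w then w else Leaf.

Inductive evaluates (P : program) : data -> term -> data -> Prop :=
| EvArg x : evaluates P x TArg x
| EvLeaf x : evaluates P x TLeaf Leaf
| EvNode x t u v w :
    evaluates P x t v -> evaluates P x u w -> evaluates P x (TNode t u) (Node v w)
| EvHd x t v : evaluates P x t v -> evaluates P x (THd t) (data_hd v)
| EvTl x t v : evaluates P x t v -> evaluates P x (TTl t) (data_tl v)
| EvIfNode x t u1 u2 v1 v2 w :
    evaluates P x t (Node v1 v2) -> evaluates P x u1 w ->
    evaluates P x (TIf t u1 u2) w
| EvIfLeaf x t u1 u2 w :
    evaluates P x t Leaf -> evaluates P x u2 w -> evaluates P x (TIf t u1 u2) w
| EvCall x k t body v w :
    evaluates P x t v -> onth P k = Some body -> evaluates P v body w ->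
    evaluates P x (TCall k t) w.

Definition program_outputs (P : program) (input output : data) : Prop :=
  evaluates P input (TCall 0 TArg) output.

Definition code_nat (n : nat) : data := iter n (Node Leaf) Leaf.
Definition code_bool (b : bool) : data := code_nat b.
Definition code_seq (T : Type) (f : T -> data) (s : seq T) : data :=
  foldr (fun x v => Node (f x) v) Leaf s.
Definition code_node (tag : nat) (args : seq data) : data :=
  Node (code_nat tag) (code_seq id args).

Fixpoint code_formula (A : formula) : data :=
  match A with
  | Atom a => code_node 0 [:: code_nat a]
  | NAtom a => code_node 1 [:: code_nat a]
  | Par B C => code_node 2 [:: code_formula B; code_formula C]
  | Tens B C => code_node 3 [:: code_formula B; code_formula C]
  | Box B => code_node 4 [:: code_formula B]
  | Dia B => code_node 5 [:: code_formula B]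
  end.

Fixpoint code_ctx (C : ctx) : data :=
  match C with
  | Hole => code_node 0 [::]
  | CParL D A => code_node 1 [:: code_ctx D; code_formula A]
  | CParR A D => code_node 2 [:: code_formula A; code_ctx D]
  | CTensL D A => code_node 3 [:: code_ctx D; code_formula A]
  | CTensR A D => code_node 4 [:: code_formula A; code_ctx D]
  | CBox D => code_node 5 [:: code_ctx D]
  | CDia D => code_node 6 [:: code_ctx D]
  end.

Definition code_sequent : seq formula -> data := code_seq code_formula.

(** The label [U] of a quantum rule is not finite data and is not coded:
    circuits refer to it through the address of the rule. *)
Fixpoint code_proof (R : realType) (Gamma : seq formula) (p : proof R Gamma) :
    data :=
  match p with
  | PAx A => code_node 0 [:: code_formula A]
  | PCut A Gamma Delta q r =>
      code_node 1 [:: code_formula A; code_sequent Gamma; code_sequent Delta;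
                      code_proof q; code_proof r]
  | PPar A B Gamma q =>
      code_node 2 [:: code_formula A; code_formula B; code_sequent Gamma;
                      code_proof q]
  | PTens A B Gamma Delta q r =>
      code_node 3 [:: code_formula A; code_formula B; code_sequent Gamma;
                      code_sequent Delta; code_proof q; code_proof r]
  | PQ n A B _ _ _ _ q =>
      code_node 4 [:: code_nat n; code_formula A; code_formula B; code_proof q]
  | PExch Gamma A B Delta q =>
      code_node 5 [:: code_sequent Gamma; code_formula A; code_formula B;
                      code_sequent Delta; code_proof q]
  end.

Definition code_gate (g : gate) : data :=
  code_node 0 [:: code_seq code_bool (g_rule g); code_bool (g_adjoint g);
                  code_nat (g_wire g)].

Definition code_circuit : circuit -> data := code_seq code_gate.

(* Main.v *)
Require Import Defs.
From mathcomp Require Import all_boot all_order all_algebra.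
From mathcomp Require Import spectral reals complex.
From Stdlib Require Import Operators_Properties.
From mathcomp Require Import zify.
From mathcomp Require mxtens.

Set Implicit Arguments.
Unset Strict Implicit.
Unset Printing Implicit Defensive.

(** Forgetting the formulas of a context leaves the path from the root of its
    formula to an atom, and contexts of a formula correspond to the paths of its
    atoms; the passage to the dual is the identity on paths.  By induction on a
    subproof, a token that enters its conclusion at a negative atom leaves it at
    a positive atom, with the same stack, after a sequence of gates that acts on
    the wires of the context only and does not depend on the stack.  At a cut the
    token bounces between the two premises; this stops because the moves of the
    token are injective on the finitely many atoms and the entry point has no
    predecessor.  Since the stack is restored, the token leaves the premise of a
    quantum rule with the modalities it brought in on top of its stack, so it is
    never stuck, and the label is applied exactly when it leaves through the
    other formula.  The same recursion, run on the codes of the proof and of the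
    path, is the extractor. *)

(** * Contexts as paths *)

(** [Some false] and [Some true] descend into the left and right subformula of a
    connective, [None] goes under a modality. *)
Definition path := seq (option bool).

Fixpoint path_of (C : ctx) : path :=
  match C with
  | Hole => [::]
  | CParL D _ | CTensL D _ => Some false :: path_of D
  | CParR _ D | CTensR _ D => Some true :: path_of D
  | CBox D | CDia D => None :: path_of D
  end.

(** Inverse of [path_of] on the contexts for [A]; [Hole] is also the junk value where the word stops
    fitting [A]. *)
Fixpoint ctx_at (A : formula) (w : path) : ctx :=
  match A, w with
  | Par B C, Some b :: w =>
      if b then CParR B (ctx_at C w) else CParL (ctx_at B w) C
  | Tens B C, Some b :: w =>
      if b then CTensR B (ctx_at C w) else CTensL (ctx_at B w) C
  | Box B, None :: w => CBox (ctx_at B w)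
  | Dia B, None :: w => CDia (ctx_at B w)
  | _, _ => Hole
  end.

(** Polarity of the atom that [w] leads to, [None] if [w] is not the path of an
    atom. *)
Fixpoint leaf (A : formula) (w : path) : option bool :=
  match A, w with
  | Atom _, [::] => Some true
  | NAtom _, [::] => Some false
  | Par B C, Some b :: w | Tens B C, Some b :: w =>
      if b then leaf C w else leaf B w
  | Box B, None :: w | Dia B, None :: w => leaf B w
  | _, _ => None
  end.

Definition wires (w : path) : nat := count_mem None w.

Definition polar (s : bool) (C : ctx) (A : formula) : Prop :=
  if s then positive C A else negative C A.

Lemma dualK : involutive dual.
Proof. by elim=> //= [A -> B ->|A -> B ->|A ->|A ->]. Qed.

Lemma leaf_dual A w : leaf (dual A) w = omap negb (leaf A w).
Proof.
by elim: A w => [a|a|A IHA B IHB|A IHA B IHB|A IHA|A IHA] [|[[]|] w] /=.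
Qed.

Lemma cdual_ctx_at A w : cdual (ctx_at A w) = ctx_at (dual A) w.
Proof.
by elim: A w => [a|a|A IHA B IHB|A IHA B IHB|A IHA|A IHA] [|[[]|] w] //=;
   rewrite ?IHA ?IHB.
Qed.

Lemma path_of_cdual C : path_of (cdual C) = path_of C.
Proof. by elim: C => //= [C ->|A C ->|C ->|A C ->|C ->|C ->]. Qed.

Lemma depth_path C : depth C = wires (path_of C).
Proof. by elim: C => //= [C ->|C ->]; rewrite add1n. Qed.

Lemma leaf_fill C X : leaf (fill C X) (path_of C) = leaf X [::].
Proof. by elim: C. Qed.

Lemma ctx_at_fill C X : ctx_at (fill C X) (path_of C) = C.
Proof.
by elim: C X => /= [[]|C IH A X|A C IH X|C IH A X|A C IH X|C IH X|C IH X] //;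
   rewrite IH.
Qed.

Lemma context_for_ctx_at C A : context_for C A -> ctx_at A (path_of C) = C.
Proof. by case=> X ->; exact: ctx_at_fill. Qed.

Lemma polarP s C A :
  polar s C A <-> leaf A (path_of C) = Some s /\ ctx_at A (path_of C) = C.
Proof.
split.
  by case: s => -[a ->]; rewrite leaf_fill ctx_at_fill.
suff polar_at w : leaf A w = Some s -> polar s (ctx_at A w) A.
  by case=> /polar_at + e; rewrite e.
elim: A w => [a|a|A IHA B IHB|A IHA B IHB|A IHA|A IHA] [|[[]|] w] //=;
  try (by case=> <-; exists a);
  (move=> /IHA || move=> /IHB); case: (s) => -[a e]; exists a; by rewrite /= -e.
Qed.

Lemma polar_ctx_at s A w : leaf A w = Some s ->
  polar s (ctx_at A w) A /\ path_of (ctx_at A w) = w.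
Proof.
suff path_ctx_at : leaf A w = Some s -> path_of (ctx_at A w) = w.
  move=> Aw; split; last exact: path_ctx_at.
  by apply/polarP; rewrite path_ctx_at.
elim: A w => [a|a|A IHA B IHB|A IHA B IHB|A IHA|A IHA] [|[[]|] w] //=;
  by (move=> /IHA -> || move=> /IHB ->).
Qed.

Lemma polar_inj s t C A : polar s C A -> polar t C A -> s = t.
Proof. by move=> /polarP[Cs _] /polarP[]; rewrite Cs => -[]. Qed.

Lemma polar_context_for s C A : polar s C A -> context_for C A.
Proof. by case: s => -[a ->]; [exists (Atom a)|exists (NAtom a)]. Qed.

(** The hypothesis on [f] holds of [Box] and [Dia] by computation, so one lemma serves both formulas
    of a quantum rule. *)
Lemma leaf_iter (f : formula -> formula) n A w :
    (forall B v, leaf (f B) v = if v is None :: v' then leaf B v' else None) ->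
  leaf (iter n f A) (nseq n None ++ w) = leaf A w.
Proof. by move=> leaf_f; elim: n => //= n IH; rewrite leaf_f. Qed.

Lemma leaf_iterE (f : formula -> formula) n A w s :
    (forall B v, leaf (f B) v = if v is None :: v' then leaf B v' else None) ->
  leaf (iter n f A) w = Some s -> w = nseq n None ++ drop n w.
Proof.
move=> leaf_f; elim: n w => [|n IH] w /=; first by rewrite drop0.
by rewrite leaf_f; case: w => [|[] w] //= /IH {1}->.
Qed.

(** * Routing of positions through a rule *)

Definition pos := (nat * path)%type.

Definition pol (Gamma : seq formula) (x : pos) : option bool :=
  obind (leaf^~ x.2) (onth Gamma x.1).

Section Routing.
Variable R : realType.

Definition is_axiom Gamma (p : proof R Gamma) : bool :=
  if p is PAx _ then true else false.

(** A missing premise is the empty sequent: none of its positions has a polarity, so a hypothesis on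
    [pol] already yields the premise ([childP]). *)
Definition premise Gamma (p : proof R Gamma) (b : bool) : seq formula :=
  match p with
  | PAx _ => [::]
  | PCut A Gamma Delta _ _ => if b then dual A :: Delta else A :: Gamma
  | PPar A B Gamma _ => if b then [::] else [:: A, B & Gamma]
  | PTens A B Gamma Delta _ _ => if b then B :: Delta else A :: Gamma
  | PQ _ A B _ _ _ _ _ => if b then [::] else [:: A; B]
  | PExch Gamma A B Delta _ => if b then [::] else Gamma ++ [:: A, B & Delta]
  end.

(** Locates an index of [Gamma ++ Delta], with [k] the size of [Gamma]; the successors skip the
    active formula at the head of each premise. *)
Definition split_index (k i : nat) : bool * nat :=
  if i < k then (false, i.+1) else (true, (i - k).+1).

(** The position of a premise at which a token entering the conclusion at [x]
    continues. *)
Definition up Gamma (p : proof R Gamma) (x : pos) : bool * pos :=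
  match p with
  | PAx _ => (false, x)
  | PCut _ Gamma _ _ _ =>
      let: (b, i) := split_index (size Gamma) x.1 in (b, (i, x.2))
  | PPar _ _ _ _ =>
      match x with
      | (0, Some true :: w) => (false, (1, w))
      | (0, w) => (false, (0, behead w))
      | (i.+1, w) => (false, (i.+2, w))
      end
  | PTens _ _ Gamma _ _ _ =>
      match x with
      | (0, Some true :: w) => (true, (0, w))
      | (0, w) => (false, (0, behead w))
      | (i.+1, w) => let: (b, i) := split_index (size Gamma) i in (b, (i, w))
      end
  | PQ n _ _ _ _ _ _ _ => (false, (x.1, drop n x.2))
  | PExch Gamma _ _ _ _ => (false, (exch_index (size Gamma) x.1, x.2))
  end.

(** The position of the conclusion reached by a token leaving the premise [b] at
    [y], or [None] if [y] lies in the cut formula. *)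
Definition down Gamma (p : proof R Gamma) (b : bool) (y : pos) : option pos :=
  match p with
  | PAx _ => None
  | PCut _ Gamma _ _ _ =>
      if y is (j.+1, w) then Some (if b then size Gamma + j else j, w) else None
  | PPar _ _ _ _ =>
      Some match y with
           | (0, w) => (0, Some false :: w)
           | (1, w) => (0, Some true :: w)
           | (j.+2, w) => (j.+1, w)
           end
  | PTens _ _ Gamma _ _ _ =>
      Some match y with
           | (0, w) => (0, Some b :: w)
           | (j.+1, w) => ((if b then size Gamma + j else j).+1, w)
           end
  | PQ n _ _ _ _ _ _ _ => Some (y.1, nseq n None ++ y.2)
  | PExch Gamma _ _ _ _ => Some (exch_index (size Gamma) y.1, y.2)
  end.

Lemma exch_indexK k : involutive (exch_index k).
Proof. by move=> i; rewrite /exch_index; do !case: eqP => //; lia. Qed.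

Lemma onth_exch (Gamma Delta : seq formula) A B i :
  onth (Gamma ++ [:: A, B & Delta]) (exch_index (size Gamma) i) =
  onth (Gamma ++ [:: B, A & Delta]) i.
Proof.
rewrite /exch_index !onth_cat; case: eqP => [->|ne].
  by rewrite ltnNge leqnSn ltnn subSnn subnn.
case: eqP => [->|ne']; first by rewrite ltnn ltnNge leqnSn /= subSnn subnn.
(* Past [Gamma] and different from both exchanged indices, [i] is at least two beyond [Gamma]. *)
case: ltnP => // ge_i; have [j ->] : exists j, i = (size Gamma + j.+2).
  by exists (i - size Gamma - 2); lia.
by rewrite addKn.
Qed.

(** Together with [down_up]: for a rule other than the axiom, [up p] is a polarity-preserving
    bijection from the atoms of the conclusion onto those atoms of the premises that lie outside a
    cut formula. *)
Lemma up_down Gamma (p : proof R Gamma) x s :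
    ~~ is_axiom p -> pol Gamma x = Some s ->
  pol (premise p (up p x).1) (up p x).2 = Some s /\
  down p (up p x).1 (up p x).2 = Some x.
Proof.
case: p => [//|A Ga D q r|A B Ga q|A B Ga D q r|n A B U n0 UU m q|Ga A B D q] _;
  case: x => i w; rewrite /pol /=.
- by rewrite onth_cat /split_index; case: ltnP => /= ik //; rewrite subnKC.
- by case: i w => [|i] [|[[]|] w] //=.
- case: i w => [|i] w /=; first by case: w => [|[[]|] w] //=.
  by rewrite onth_cat /split_index; case: ltnP => /= ik //; rewrite subnKC.
- case: i => [|[|i]] /=; last by rewrite onth0n.
    by move=> /[dup] /leaf_iterE -> //; rewrite drop_size_cat ?size_nseq ?leaf_iter.
  by move=> /[dup] /leaf_iterE -> //; rewrite drop_size_cat ?size_nseq ?leaf_iter.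
- by rewrite onth_exch exch_indexK.
Qed.

Lemma down_up Gamma (p : proof R Gamma) b y z s :
    pol (premise p b) y = Some s -> down p b y = Some z ->
  pol Gamma z = Some s /\ up p z = (b, y).
Proof.
case: p => [//|A Ga D q r|A B Ga q|A B Ga D q r|n A B U n0 UU m q|Ga A B D q];
  case: y => j w; rewrite /pol /=.
- case: j => //= j; case: b => /= + [<-] /=; rewrite onth_cat /split_index.
    by rewrite ltnNge leq_addr addKn.
  case: ltnP => // jk.
  by rewrite onth_default.
- by case: b; rewrite /= ?onth0n //; case: j => [|[|j]] /= + [<-] /=.
- case: j => [|j] /=; first by case: b => /= + [<-] /=.
  case: b => /= + [<-] /=; rewrite onth_cat /split_index.
    by rewrite ltnNge leq_addr addKn.
  case: ltnP => // jk.
  by rewrite onth_default.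
- case: b => /=; first by rewrite onth0n.
  move=> + [<-]; rewrite /= drop_size_cat ?size_nseq //.
  by case: j => [|[|j]] /=; rewrite ?leaf_iter // onth0n.
- by case: b; rewrite /= ?onth0n // => + [<-]; rewrite /= onth_exch exch_indexK.
Qed.

(** For an atom of a premise, [down] fails only at the head of a premise of a cut. The same path
    leads to the dual atom in the other premise, so a positive exit is a negative entry there. *)
Lemma bounce Gamma (p : proof R Gamma) b y s :
    pol (premise p b) y = Some s -> down p b y = None ->
  pol (premise p (~~ b)) y = Some (~~ s) /\ down p (~~ b) y = None.
Proof.
case: p => [//|A Ga D q r|A B Ga q|A B Ga D q r|n A B U n0 UU m q|Ga A B D q];
  case: y => [[|j] w] //; rewrite /pol /=.
by case: b => /=; rewrite leaf_dual; [case: leaf => //= -[] [<-]|move=> ->].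
Qed.

End Routing.

(** * Traversals *)

Section Traversal.
Variable R : realType.

Definition child Gamma (p : proof R Gamma) (b : bool) :
    option (proof R (premise p b)) :=
  match p with
  | PAx _ => None
  | PCut _ _ _ q r => if b is true then Some r else Some q
  | PPar _ _ _ q => if b is true then None else Some q
  | PTens _ _ _ _ q r => if b is true then Some r else Some q
  | PQ _ _ _ _ _ _ _ q => if b is true then None else Some q
  | PExch _ _ _ _ q => if b is true then None else Some q
  end.

Definition modalities Gamma (p : proof R Gamma) : nat :=
  if p is PQ n _ _ _ _ _ _ _ then n else 0.

(** The gate emitted by a token that entered the rule instance at address [a]
    through the [i]-th formula of the conclusion and leaves it from [y]. *)
Definition emission Gamma (p : proof R Gamma) (a : address) (i : nat) (y : pos) :
    circuit :=
  match p with
  | PQ _ _ _ _ _ _ _ _ =>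
      if y.1 == i then [::] else [:: Gate a (i == 1) (wires y.2)]
  | _ => [::]
  end.

(** [trav p a x y c]: a token entering the conclusion of [p] at [x] leaves it at
    [y], having gone through the gates [c]; [a] is the address of [p].
    [loop p a i b x y c] is the part of such a run that starts at the position
    [x] of the premise [b], [i] being the index of the entry formula. *)
Inductive trav Gamma (p : proof R Gamma) (a : address) :
    pos -> pos -> circuit -> Prop :=
| TravAx x : is_axiom p -> trav p a x (1 - x.1, x.2) [::]
| TravRule x y c : ~~ is_axiom p ->
    loop p a x.1 (up p x).1 (up p x).2 y c -> trav p a x y c
with loop Gamma (p : proof R Gamma) (a : address) :
    nat -> bool -> pos -> pos -> circuit -> Prop :=
| LoopExit i b q x y z c : child p b = Some q ->
    trav q (rcons a b) x y c -> down p b y = Some z ->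
    loop p a i b x z (c ++ emission p a i y)
| LoopBack i b q x y z c c' : child p b = Some q ->
    trav q (rcons a b) x y c -> down p b y = None ->
    loop p a i (~~ b) y z c' -> loop p a i b x z (c ++ c').

Lemma travE Gamma (p : proof R Gamma) a x y c : trav p a x y c ->
  if is_axiom p then y = (1 - x.1, x.2)
  else loop p a x.1 (up p x).1 (up p x).2 y c.
Proof. by case=> {x y c} [x ->|x y c /negPf ->]. Qed.

(** Subtraction is truncated, so this involution needs an index at most 1, which [pol] provides. *)
Lemma axiom_indexK Gamma (p : proof R Gamma) x s :
  is_axiom p -> pol Gamma x = Some s -> 1 - (1 - x.1) = x.1.
Proof.
by case: p => // A _; case: x => [[|[|i]] w]; rewrite /pol /= ?onth0n.
Qed.

(** Structural induction that names no rule, so that [trav_bijective] treats all rules other than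
    the axiom at once. *)
Lemma proof_child_ind (P : forall Gamma, proof R Gamma -> Prop) :
    (forall Gamma (p : proof R Gamma),
       (forall b q, child p b = Some q -> P _ q) -> P _ p) ->
  forall Gamma (p : proof R Gamma), P _ p.
Proof.
move=> step Ga p.
by elim: p => [A|A G D q IHq r IHr|A B G q IHq|A B G D q IHq r IHr
  |n A B U n0 UU m q IHq|G A B D q IHq]; apply: step => -[] q' //= [<-].
Qed.

Lemma childP Gamma (p : proof R Gamma) b x s :
  pol (premise p b) x = Some s -> exists q, child p b = Some q.
Proof.
case: x => i w; rewrite /pol.
by case: p => [A|A G D q r|A B G q|A B G D q r|n A B U n0 UU m q|G A B D q];
  case: b; rewrite /= ?onth0n //; eauto.
Qed.

Lemma child_nonaxiom Gamma (p : proof R Gamma) b q :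
  child p b = Some q -> ~~ is_axiom p.
Proof. by case: p q. Qed.

Lemma wires_nseq n w : wires (nseq n None ++ w) = n + wires w.
Proof. by rewrite /wires count_cat count_nseq mul1n. Qed.

(** Modalities popped from the stack on the way down reappear in the context, which keeps the number
    of qubits constant. *)
Lemma wires_down Gamma (p : proof R Gamma) b y z :
  down p b y = Some z -> wires z.2 = wires y.2 + modalities p.
Proof.
case: y => j w.
case: p => [//|A G D q r|A B G q|A B G D q r|n A B U n0 UU m q|G A B D q] /=.
- by case: j => //= j [<-] /=; rewrite addn0.
- by case: j => [|[|j]] [<-] /=; rewrite addn0.
- by case: j => [|j] [<-] /=; rewrite addn0.
- by case=> <- /=; rewrite wires_nseq addnC.
- by case=> <- /=; rewrite addn0.
Qed.

Scheme trav_mind := Minimality for trav Sort Prop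
  with loop_mind := Minimality for loop Sort Prop.
Combined Scheme trav_loop_ind from trav_mind, loop_mind.

(** Entering a premise strips [modalities p] wires off the path, bounces keep the path, and the exit
    puts them back; hence the offset in the claim on [loop]. *)
Lemma trav_loop_pol Gamma (p : proof R Gamma) a :
  (forall x y c, trav p a x y c ->
     pol Gamma x = Some false ->
     pol Gamma y = Some true /\ wires y.2 = wires x.2) /\
  (forall i b x y c, loop p a i b x y c ->
     pol (premise p b) x = Some false ->
     pol Gamma y = Some true /\ wires y.2 = wires x.2 + modalities p).
Proof.
apply: (trav_loop_ind
  (P := fun Ga (p : proof R Ga) a x y c => pol Ga x = Some false ->
     pol Ga y = Some true /\ wires y.2 = wires x.2)
  (P0 := fun Ga (p : proof R Ga) a i b x y c =>
     pol (premise p b) x = Some false ->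
     pol Ga y = Some true /\ wires y.2 = wires x.2 + modalities p)) =>
  {Gamma p a} Ga p a.
- case=> i w; case: p => // A _; rewrite /pol /=.
  case: i => [|[|i]] /=; rewrite ?onth0n ?leaf_dual //=; last by move=> ->.
  by case: leaf => //= -[].
- move=> x y c nax _ IH xn.
  have [up_pol down_eq] := up_down nax xn; have [-> ->] := IH up_pol; split=> //.
  by rewrite -(wires_down down_eq).
- move=> i b q x y z c _ _ IH yz /IH[yp <-].
  by have [-> _] := down_up yp yz; rewrite (wires_down yz).
- move=> i b q x y z c c' _ _ IH yz _ IHl /IH[yp <-].
  by have [yn _] := bounce yp yz; exact: IHl.
Qed.

Lemma trav_pol Gamma (p : proof R Gamma) a x y c :
    trav p a x y c -> pol Gamma x = Some false ->
  pol Gamma y = Some true /\ wires y.2 = wires x.2.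
Proof. exact: (trav_loop_pol p a).1. Qed.

Lemma finite_pol Gamma : exists E : seq pos, forall x s,
  pol Gamma x = Some s -> x \in E.
Proof.
have finite_leaf A : exists E : seq path, forall w s, leaf A w = Some s -> w \in E.
  elim: A => [a|a|A [E EP] B [F FP]|A [E EP] B [F FP]|A [E EP]|A [E EP]].
  - by exists [:: [::]] => -[].
  - by exists [:: [::]] => -[].
  - exists (map (cons (Some false)) E ++ map (cons (Some true)) F).
    move=> [|[[]|] w] s //= ws; rewrite mem_cat; apply/orP; [right|left];
    by apply: map_f; eauto.
  - exists (map (cons (Some false)) E ++ map (cons (Some true)) F).
    move=> [|[[]|] w] s //= ws; rewrite mem_cat; apply/orP; [right|left];
    by apply: map_f; eauto.
  - by exists (map (cons None) E) => -[|[[]|] w] s //= ws; apply: map_f; eauto.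
  - by exists (map (cons None) E) => -[|[[]|] w] s //= ws; apply: map_f; eauto.
elim: Gamma => [|A Ga [E EP]]; first by exists [::] => -[i w] s; rewrite /pol onth0n.
have [F FP] := finite_leaf A.
exists (map (pair 0) F ++ map (fun x => (x.1.+1, x.2)) E) => -[[|i] w] s ws;
  rewrite mem_cat; apply/orP; [left|right].
  by apply: map_f; exact: FP ws.
by apply/mapP; exists (i, w) => //; exact: (EP (i, w) s ws).
Qed.

(** An injective relation cannot run into a cycle from a point without predecessor, so inside a
    finite set the run has to meet [stop]. *)
Lemma escape (T : eqType) (S : T -> T -> Prop) (stop : T -> Prop) (E : seq T) x0 :
    (forall x y z, S x z -> S y z -> x = y) -> (forall x, ~ S x x0) ->
    (forall x, x \in E -> stop x \/ exists2 y, S x y & y \in E) -> x0 \in E ->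
  exists2 x, clos_refl_trans_n1 T S x0 x & stop x.
Proof.
move=> S_inj x0_first progress x0E.
(* [v] collects the points visited before [x], each of which is [x0] or has its predecessor in [v];
   [n] bounds how many more can be visited. *)
suff: forall n v x, size v + n = size E -> uniq (x :: v) -> {subset x :: v <= E} ->
    (forall y, y \in x :: v -> y = x0 \/ exists2 u, u \in v & S u y) ->
    clos_refl_trans_n1 T S x0 x -> exists2 x, clos_refl_trans_n1 T S x0 x & stop x.
  move=> /(_ (size E) [::] x0); apply => //.
  - by move=> y /[!inE] /eqP ->.
  - by move=> y /[!inE] /eqP ->; left.
  - exact: rtn1_refl.
elim=> [|n IH] v x sz xv sub pred x0x.
  by have := uniq_leq_size xv sub; rewrite -sz addn0 ltnn.
have [|x_stop|[y xy yE]] := progress x; first by apply: sub; exact: mem_head.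
  by exists x.
(* A revisited point would be [x0] with a predecessor, or would have two distinct predecessors. *)
have yxv : y \notin x :: v.
  apply/negP => /pred[y0|[u uv uy]]; first by apply: (x0_first x); rewrite -y0.
  by move: xv; rewrite (S_inj _ _ _ xy uy) /= uv.
apply: (IH (x :: v) y) => //.
- by rewrite -sz addnS addSn.
- by rewrite cons_uniq yxv.
- by move=> z; rewrite inE => /predU1P[->|/sub].
- move=> z; rewrite inE => /predU1P[->|/pred[->|[u uv uz]]].
  + by right; exists x => //; exact: mem_head.
  + by left.
  + by right; exists u => //; rewrite inE uv orbT.
- exact: (@Relation_Operators.rtn1_trans _ _ _ _ _ xy x0x).
Qed.

(** Two backward runs of an injective relation from the same point are
    comparable. *)
Lemma same_origin (T : Type) (S : T -> T -> Prop) x y z :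
    (forall x y z, S x z -> S y z -> x = y) ->
    (forall u, ~ S u x) -> (forall u, ~ S u y) ->
    clos_refl_trans_n1 T S x z -> clos_refl_trans_n1 T S y z -> x = y.
Proof.
move=> S_inj xf yf; elim=> [|u v uv _ IH] yz.
  by case: yz xf => // u v uv _ /(_ u).
by apply: IH; case: yz uv => [/yf//|u' w u'w yu' uw]; rewrite (S_inj _ _ _ uw u'w).
Qed.

(** One traversal of a premise of a cut followed by the bounce into the other premise, gates
    forgotten. The clause on polarity is there because traversals are injective from negative
    positions only. *)
Definition turns Gamma (p : proof R Gamma) (a : address) (u v : bool * pos) : Prop :=
  [/\ pol (premise p u.1) u.2 = Some false,
      exists q c, child p u.1 = Some q /\ trav q (rcons a u.1) u.2 v.2 c,
      down p u.1 v.2 = None & v.1 = ~~ u.1].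

Definition leaves Gamma (p : proof R Gamma) (a : address) (u : bool * pos)
    (z : pos) : Prop :=
  exists q y c, [/\ child p u.1 = Some q, trav q (rcons a u.1) u.2 y c
    & down p u.1 y = Some z].

(** A turn ends in the cut formula, where [down] fails, whereas [down] sends the entry point back to
    [x]. *)
Lemma turns_entry Gamma (p : proof R Gamma) a x u :
  ~~ is_axiom p -> pol Gamma x = Some false -> ~ turns p a u (up p x).
Proof.
move=> nax xn [un [q [c [qb qt]]] back ux].
have [_] := up_down nax xn; rewrite ux; have [yp _] := trav_pol qt un.
by have [_ ->] := bounce yp back.
Qed.

(** With its converse [turns_loop], recasts a loop as an iteration of [turns], to which [escape] and
    [same_origin] apply. *)
Lemma loop_turns Gamma (p : proof R Gamma) a i b x z c :
    pol (premise p b) x = Some false -> loop p a i b x z c ->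
  exists v, [/\ clos_refl_trans_1n _ (turns p a) (b, x) v,
    pol (premise p v.1) v.2 = Some false & leaves p a v z].
Proof.
move=> + l; elim: l => {Gamma p a i b x z c} [Ga p a i b q x y z c qb qt yz|
  Ga p a i b q x y z c c' qb qt yb _ IH] xn.
  by exists (b, x); split=> //; [exact: rt1n_refl|exists q, y, c].
have [yp _] := trav_pol qt xn; have [yn _] := bounce yp yb.
have [v [yv vn vz]] := IH yn; exists v; split=> //.
by apply: (Relation_Operators.rt1n_trans _ _ _ (~~ b, y)) yv; split=> //; exists q, c.
Qed.

Lemma turns_loop Gamma (p : proof R Gamma) a i u v z :
    clos_refl_trans_1n _ (turns p a) u v -> leaves p a v z ->
  exists c, loop p a i u.1 u.2 z c.
Proof.
elim=> {u v} [u [q [y [c [qb qt yz]]]]|u v w [un [q [c [qb qt]]] back vu] _ IH wz].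
  by exists (c ++ emission p a i y); exact: LoopExit qb qt yz.
have [c' l] := IH wz; exists (c ++ c').
by apply: LoopBack qb qt back _; rewrite -vu.
Qed.

(** Totality and injectivity need a joint induction: the bounces at a cut terminate because the
    traversals of its premises are injective. *)
Lemma trav_bijective Gamma (p : proof R Gamma) :
  (forall a x, pol Gamma x = Some false -> exists y c, trav p a x y c) /\
  (forall a x x' y c c', pol Gamma x = Some false -> pol Gamma x' = Some false ->
     trav p a x y c -> trav p a x' y c' -> x = x').
Proof.
elim/proof_child_ind: Gamma / p => Ga p IH.
have turns_inj a u u' v : turns p a u v -> turns p a u' v -> u = u'.
  case: u u' v => [b x] [b' x'] [d y] [/= xn [q [c [qb qt]]] _ ->].
  case=> /= x'n [q' [c' [q'b q't]]] _ /negb_inj e.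
  move: x'n q' q'b q't; rewrite -e => x'n q'; rewrite qb => -[<-] q't.
  by have [_ q_inj] := IH _ _ qb; rewrite (q_inj _ _ _ _ _ _ xn x'n qt q't).
have loop_of z : ~~ is_axiom p -> pol Ga z = Some false ->
    pol (premise p (up p z).1) (up p z).2 = Some false.
  by move=> nax zn; case: (up_down nax zn).
split=> [a x xn|a x x' y c c' xn x'n].
  have [ax|nax] := boolP (is_axiom p).
    by exists (1 - x.1, x.2), [::]; exact: TravAx.
  have [E0 E0P] := finite_pol (premise p false).
  have [E1 E1P] := finite_pol (premise p true).
  (* The finitely many places from which a turn can start: the negative atoms of both premises. *)
  pose E := [seq u <- map (pair false) E0 ++ map (pair true) E1
            | pol (premise p u.1) u.2 == Some false].
  have EP (u : bool * pos) : reflect (pol (premise p u.1) u.2 = Some false) (u \in E).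
    rewrite mem_filter; apply: (iffP andP) => [[/eqP]//|un]; split; first exact/eqP.
    by case: u un => -[] u /= un; rewrite mem_cat map_f ?orbT //; eauto.
  have [||v xv [z vz]] :=
      escape (stop := fun v => exists z, leaves p a v z) (@turns_inj a)
        (fun u => @turns_entry _ p a x u nax xn) (E := E).
  - move=> [b u] /EP /= un; have [q qb] := childP un.
    have [/(_ (rcons a b) u un) [v [c qt]] _] := IH _ _ qb.
    have [vp _] := trav_pol qt un.
    case vz: (down p b v) => [z|]; first by left; exists z, q, v, c.
    have [vn _] := bounce vp vz.
    by right; exists (~~ b, v); [split=> //; exists q, c|apply/EP].
  - by apply/EP; exact: loop_of.
  have {}xv := clos_rt_rt1n _ _ _ _ (clos_rtn1_rt _ _ _ _ xv).
  have [c l] := turns_loop x.1 xv vz; exists z, c.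
  exact: TravRule.
move=> /travE + /travE; have [ax -> e|nax l l'] := boolP (is_axiom p).
  have := axiom_indexK ax xn; have := axiom_indexK ax x'n.
  by case: x x' e {xn x'n} => [i w] [i' w'] /= [-> ->] -> ->.
have [v [xv vn vy]] := loop_turns (loop_of _ nax xn) l.
have [v' [xv' v'n v'y]] := loop_turns (loop_of _ nax x'n) l'.
have [_ xK] := up_down nax xn; have [_ x'K] := up_down nax x'n.
(* [down] undoes [up], so it is enough that the entry points into the premises agree. *)
suff e : up p x = up p x' by move: xK; rewrite e x'K => -[].
(* The exit determines the last premise and the position at which it was left; injectivity for that
   premise gives the last entry into it. *)
have vv' : v = v'.
  case: v v' vn v'n vy v'y {xv xv'} => [b u] [b' u'] /= un u'n.
  move=> [q [z [d [qb qt zy]]]] [q' [z' [d' [q'b q't z'y]]]] /=.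
  have [zp _] := trav_pol qt un; have [z'p _] := trav_pol q't u'n.
  have [_] := down_up zp zy; have [_ ->] := down_up z'p z'y.
  case=> bb' zz'; move: u'n q' q'b q't; rewrite bb' zz' => u'n q' /=.
  rewrite qb => -[<-] q't; have [_ q_inj] := IH _ _ qb.
  by rewrite (q_inj _ _ _ _ _ _ un u'n qt q't).
apply: (same_origin (@turns_inj a)).
- by move=> u; exact: turns_entry.
- by move=> u; exact: turns_entry.
- by apply/clos_rt_rtn1/clos_rt1n_rt; rewrite [up p x]surjective_pairing; exact: xv.
- by apply/clos_rt_rtn1/clos_rt1n_rt; rewrite [up p x']surjective_pairing vv'.
Qed.

End Traversal.

(** * Runs of the token machine *)

Section Unitary.
Variable R : realType.
Local Open Scope ring_scope.

Lemma adjoint_unitary n (U : 'M[R[i]]_n) :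
  U \is unitarymx -> adjoint U \is unitarymx.
Proof. by rewrite /adjoint trmxC_unitary. Qed.

Lemma on_qubits_unitary n d k m (e : (d + n + k = m)%N) (U : 'M[R[i]]_(2 ^ n)) :
  U \is unitarymx -> on_qubits e U \is unitarymx.
Proof.
have tens_unitary p q (A : 'M[R[i]]_p) (B : 'M[R[i]]_q) :
    A \is unitarymx -> B \is unitarymx -> mxtens.tensmx A B \is unitarymx.
  move=> /unitarymxP AA /unitarymxP BB; apply/unitarymxP.
  rewrite mxtens.trmx_tens mxtens.map_mxT mxtens.tensmx_mul AA BB.
  apply/matrixP => i j; case: (mxtens.mxtens_indexP i) => i0 i1.
  case: (mxtens.mxtens_indexP j) => j0 j1; rewrite mxtens.tensmxE !mxE.
  rewrite (inj_eq (can_inj (@mxtens.mxtens_indexK _ _))) xpair_eqE.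
  by rewrite mulr_natl -mulrnA mulnb andbC.
have one_unitary p : (1%:M : 'M[R[i]]_p) \is unitarymx.
  by apply/unitarymxP; rewrite trmx1 map_mx1 mulmx1.
have cast_unitary p q (pq : p = q) (A : 'M[R[i]]_p) :
    A \is unitarymx -> castmx (pq, pq) A \is unitarymx by case: q / pq.
by move=> UU; rewrite /on_qubits cast_unitary // !tens_unitary.
Qed.

Lemma unit_vectorE n (Q : 'cV[R[i]]_n) :
  unit_vector Q <-> map_mx Num.conj Q^T *m Q = 1%:M.
Proof.
rewrite /unit_vector.
have -> : \sum_(i < n) `|Q i 0| ^+ 2 = (map_mx Num.conj Q^T *m Q) 0 0.
  by rewrite mxE; apply: eq_bigr => i _; rewrite !mxE normCK mulrC.
split=> [e|->]; last by rewrite mxE eqxx.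
by apply/matrixP => i j; rewrite !ord1 e mxE eqxx.
Qed.

Lemma unit_vector_unitary n (U : 'M[R[i]]_n) (Q : 'cV[R[i]]_n) :
  U \is unitarymx -> unit_vector Q -> unit_vector (U *m Q).
Proof.
move=> /unitarymxP/mulmx1C UU /unit_vectorE QQ; apply/unit_vectorE.
by rewrite trmx_mul map_mxM mulmxA -(mulmxA _ _ U) UU mulmx1.
Qed.

(** Basis vectors are unit vectors, and they pick out the columns. *)
Lemma eq_on_unit_vectors n (M M' : 'M[R[i]]_n) :
  (forall Q, unit_vector Q -> M *m Q = M' *m Q) -> M = M'.
Proof.
move=> MM'; apply/matrixP => i j.
have /MM' /matrixP/(_ i 0) : unit_vector (delta_mx j 0 : 'cV[R[i]]_n).
  rewrite /unit_vector (bigD1 j) //= big1 => [|k kj].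
    by rewrite mxE !eqxx normr1 expr1n addr0.
  by rewrite mxE (negPf kj) normr0 expr0n.
by rewrite -!colE !mxE.
Qed.

(** Circuits are read from left to right, matrix products from right to left. *)
Lemma circuit_computes_cat Gamma (pi : proof R Gamma) m c c' (M M' : 'M_(2 ^ m)) :
  circuit_computes pi c M -> circuit_computes pi c' M' ->
  circuit_computes pi (c ++ c') (M' *m M).
Proof.
move=> cM c'M'; elim: cM => [|g {}c G {}M gG _ IH]; first by rewrite mulmx1.
by rewrite mulmxA; exact: CircuitCons.
Qed.

End Unitary.

Section Runs.
Variables (R : realType) (m : nat).
Local Open Scope ring_scope.
Notation config := (config R m).

(** The default [Atom 0] concerns indices outside the sequent only; a position with a polarity never
    meets it. *)
Definition conf (a : address) (Gamma : seq formula) (x : pos) (s : stack)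
    (Q : 'cV[R[i]]_(2 ^ m)) : config :=
  Config (a, x.1) (ctx_at (nth (Atom 0) Gamma x.1) x.2) s Q.

(** What a token entering through the [i]-th formula of the conclusion pushes. *)
Definition pushed Gamma (p : proof R Gamma) (i : nat) : stack :=
  if p is PQ n _ _ _ _ _ _ _ then nseq n (if i == 0 then MDia else MBox)
  else [::].

Lemma size_pushed Gamma (p : proof R Gamma) i : size (pushed p i) = modalities p.
Proof. by case: p => //= *; rewrite size_nseq. Qed.

Lemma polE Gamma x s : pol Gamma x = Some s ->
  exists2 X, onth Gamma x.1 = Some X & leaf X x.2 = Some s.
Proof. by rewrite /pol; case: onth => // X; exists X. Qed.

Lemma pol_size Gamma x s : pol Gamma x = Some s -> (x.1 < size Gamma)%N.
Proof. by move=> /polE[X]; rewrite -onthTE => ->. Qed.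

Lemma confE a Gamma i w X s Q : onth Gamma i = Some X ->
  conf a Gamma (i, w) s Q = Config (a, i) (ctx_at X w) s Q.
Proof. by move=> /(onth_nth (Atom 0)); rewrite /conf => ->. Qed.

Lemma ctx_at_iter (f : formula -> formula) (g : ctx -> ctx) n A w :
    (forall B v, ctx_at (f B) (None :: v) = g (ctx_at B v)) ->
  ctx_at (iter n f A) (nseq n None ++ w) = iter n g (ctx_at A w).
Proof. by move=> fg; elim: n => //= n IH; rewrite fg IH. Qed.

Lemma subproof_nil Gamma (p : proof R Gamma) :
  subproof p [::] = Some (existT _ Gamma p).
Proof. by case: p. Qed.

Lemma subproof_rcons Gamma (pi : proof R Gamma) a P b :
    subproof pi a = Some P ->
  subproof pi (rcons a b) = omap (existT (proof R) _) (child (projT2 P) b).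
Proof.
elim: pi a => [A|A G D q IHq r IHr|A B G q IHq|A B G D q IHq r IHr
  |n A B U n0 UU e q IHq|G A B D q IHq] [|d a] //=;
  by (case: d; auto) || (move=> [<-]; case: (b); rewrite /= ?subproof_nil).
Qed.

End Runs.

(** * Moves of a traversal as transitions *)

Section Soundness.
Variables (R : realType) (m : nat).
Local Open Scope ring_scope.
Local Notation conf := (@conf R m).

Lemma leaf_negative A w : leaf A w = Some false -> negative (ctx_at A w) A.
Proof. by case/polar_ctx_at. Qed.

Lemma leaf_positive A w : leaf A w = Some true -> positive (ctx_at A w) A.
Proof. by case/polar_ctx_at. Qed.

Lemma depth_ctx_at A w t : leaf A w = Some t -> depth (ctx_at A w) = wires w.
Proof. by case/polar_ctx_at=> _ {2}<-; rewrite depth_path. Qed.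

Hint Resolve leaf_negative leaf_positive : core.

(** Brings the context transitions of all rules to the form of [up] and [down]. *)
Lemma context_formulaP Gamma (p : proof R Gamma) X b i j :
    context_formula p X b i j ->
  [/\ onth Gamma j = Some X, onth (premise p b) i = Some X
    & forall w, up p (j, w) = (b, (i, w)) /\ down p b (i, w) = Some (j, w)].
Proof.
case=> {p X b i j} [A G D p q X i Gi|A G D p q X i Di|A B G p X i Gi
  |A B G D p q X i Gi|A B G D p q X i Di|G A B D p X i Gi] /=.
- have iG : (i < size G)%N by rewrite -onthTE Gi.
  by rewrite onth_cat /split_index iG.
- by rewrite onth_cat /split_index ltnNge leq_addr /= addKn.
- by [].
- have iG : (i < size G)%N by rewrite -onthTE Gi.
  by rewrite onth_cat /split_index iG.
- by rewrite onth_cat /split_index ltnNge leq_addr /= addKn.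
- by rewrite -onth_exch exch_indexK.
Qed.

Lemma context_up Gamma (p : proof R Gamma) X b i j a w s Q :
    context_formula p X b i j -> leaf X w = Some false ->
  rule_step a p (conf a Gamma (j, w) s Q) (conf (rcons a b) (premise p b) (i, w) s Q).
Proof.
move=> c Xw; have [Gj Pi _] := context_formulaP c.
by rewrite (confE _ _ _ _ Gj) (confE _ _ _ _ Pi); apply: ContextUp c _; auto.
Qed.

Lemma context_down Gamma (p : proof R Gamma) X b i j a w s Q :
    context_formula p X b i j -> leaf X w = Some true ->
  rule_step a p (conf (rcons a b) (premise p b) (i, w) s Q) (conf a Gamma (j, w) s Q).
Proof.
move=> c Xw; have [Gj Pi _] := context_formulaP c.
by rewrite (confE _ _ _ _ Gj) (confE _ _ _ _ Pi); apply: ContextDown c _; auto.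
Qed.

(** Orients the duality for the transitions that start from the dual formula, whose target is the
    [cdual] of a context for [dual A]. *)
Lemma ctx_at_dual A w : ctx_at A w = cdual (ctx_at (dual A) w).
Proof. by rewrite cdual_ctx_at dualK. Qed.

Lemma step_axiom Gamma (p : proof R Gamma) a x s Q :
    is_axiom p -> pol Gamma x = Some false ->
  rule_step a p (conf a Gamma x s Q) (conf a Gamma ((1 - x.1)%N, x.2) s Q).
Proof.
case: p => // A _; case: x => [[|[|i]] w] //=; rewrite /pol /= ?onth0n // => wA.
  rewrite /conf /= [ctx_at A w]ctx_at_dual.
  by apply: AxL; auto.
rewrite /conf /= -cdual_ctx_at.
by apply: AxR; auto.
Qed.

Lemma step_up Gamma (p : proof R Gamma) a x s Q :
    ~~ is_axiom p -> pol Gamma x = Some false ->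
  rule_step a p (conf a Gamma x s Q)
    (conf (rcons a (up p x).1) (premise p (up p x).1) (up p x).2
       (s ++ pushed p x.1) Q).
Proof.
case: x => i w.
case: p => [//|A G D q r|A B G q|A B G D q r|n A B U n0 UU e q|G A B D q] _;
  rewrite /pol /= ?cats0.
- rewrite onth_cat /split_index; case: ltnP => iG /=.
    case Gi: onth => [X|//] Xw; apply: (context_up (p := PCut _ _ _ q r)) Xw.
    exact: CFCutL.
  case Gi: onth => [X|//] Xw; apply: (context_up (p := PCut _ _ _ q r)) Xw.
  by rewrite -{2}(subnKC iG); exact: CFCutR.
- case: i w => [|i] w /=.
    by case: w => [|[[]|] w] //= Xw; [apply: ParUpR|apply: ParUpL]; auto.
  by case Gi: onth => [X|//] Xw; apply: (context_up (p := PPar _ _ _ q)) Xw; exact: CFPar.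
- case: i w => [|i] w /=.
    by case: w => [|[[]|] w] //= Xw; [apply: TensUpR|apply: TensUpL]; auto.
  rewrite onth_cat /split_index; case: ltnP => iG /=.
    case Gi: onth => [X|//] Xw; apply: (context_up (p := PTens _ _ _ _ q r)) Xw.
    exact: CFTensL.
  case Gi: onth => [X|//] Xw; apply: (context_up (p := PTens _ _ _ _ q r)) Xw.
  by rewrite -{2}(subnKC iG); exact: CFTensR.
- case: i => [|[|i]] /=; last by rewrite onth0n.
    move=> /[dup] /leaf_iterE -> //; rewrite leaf_iter // => Xw.
    rewrite drop_size_cat ?size_nseq // /conf /= (@ctx_at_iter Dia CDia) //.
    by apply: QUpDia; auto.
  move=> /[dup] /leaf_iterE -> //; rewrite leaf_iter // => Xw.
  rewrite drop_size_cat ?size_nseq // /conf /= (@ctx_at_iter Box CBox) //.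
  by apply: QUpBox; auto.
- rewrite -onth_exch; case Gi: onth => [X|//] Xw.
  apply: (context_up (p := PExch _ _ _ _ q)) Xw.
  by rewrite -{2}(exch_indexK (size G) i); exact: CFExch.
Qed.

Lemma step_bounce Gamma (p : proof R Gamma) a b y s Q :
    pol (premise p b) y = Some true -> down p b y = None ->
  rule_step a p (conf (rcons a b) (premise p b) y s Q)
    (conf (rcons a (~~ b)) (premise p (~~ b)) y s Q).
Proof.
case: p => [//|A G D q r|A B G q|A B G D q r|n A B U n0 UU e q|G A B D q] //=;
  case: y => [[|j] w]; rewrite /pol /= ?onth0n // => + _.
case: b => /= Xw; rewrite /conf /=.
  by rewrite [ctx_at A w]ctx_at_dual; apply: CutR; auto.
by rewrite -cdual_ctx_at; apply: CutL; auto.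
Qed.

(** At a quantum rule the block pushed on entry selects the exit transition, which applies the label
    exactly when [emission] is a gate. [G] is chosen before the register, so one matrix serves all
    inputs. *)
Lemma step_down Gamma (p : proof R Gamma) Delta (pi : proof R Delta) a b i y z s :
    subproof pi a = Some (existT _ _ p) -> (i < size Gamma)%N ->
    pol (premise p b) y = Some true -> down p b y = Some z ->
    (wires z.2 + size s = m)%N ->
  exists G : 'M[R[i]]_(2 ^ m),
    [/\ circuit_computes pi (emission p a i y) G, G \is unitarymx
      & forall Q, rule_step a p
          (conf (rcons a b) (premise p b) y (s ++ pushed p i) Q)
          (conf a Gamma z s (G *m Q))].
Proof.
have one_ok : circuit_computes pi [::] (1%:M : 'M_(2 ^ m)) /\
    (1%:M : 'M[R[i]]_(2 ^ m)) \is unitarymx.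
  by split; [exact: CircuitNil|apply/unitarymxP; rewrite trmx1 map_mx1 mulmx1].
case: one_ok => one_computes one_unitary; case: y => j w.
case: p => [//|A G D q r|A B G q|A B G D q r|n A B U n0 UU e q|G A B D q] pia iG;
  rewrite /pol /= => H zE zm.
- exists 1%:M; split=> // Q; rewrite mul1mx cats0; move: zE H.
  case: j => // j [<-] /=; case: b => /=; case Gi: onth => [X|//] Xw;
  by apply: (context_down (p := PCut _ _ _ q r)) Xw; (exact: CFCutR || exact: CFCutL).
- exists 1%:M; split=> // Q; rewrite mul1mx cats0; move: zE H.
  case: b => /=; rewrite ?onth0n //; case: j => [|[|j]] /= [<-] Xw.
  + by apply: ParDownL; auto.
  + by apply: ParDownR; auto.
  + move: Xw; case Gi: onth => [X|//] Xw.
    by apply: (context_down (p := PPar _ _ _ q)) Xw; exact: CFPar.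
- exists 1%:M; split=> // Q; rewrite mul1mx cats0; move: zE H.
  case: j => [|j] [<-] /=; case: b => /= Xw.
  + by apply: TensDownR; auto.
  + by apply: TensDownL; auto.
  + move: Xw; case Gi: onth => [X|//] Xw.
    by apply: (context_down (p := PTens _ _ _ _ q r)) Xw; exact: CFTensR.
  + move: Xw; case Gi: onth => [X|//] Xw.
    by apply: (context_down (p := PTens _ _ _ _ q r)) Xw; exact: CFTensL.
- move: H; case: b => /=; first by rewrite onth0n.
  case: zE zm => <- /=; rewrite wires_nseq => zm Xw0.
  (* The wires of the context come first, then the [n] wires of the label, then those of the
     stack. *)
  have e0 : (wires w + n + size s = m)%N by rewrite (addnC (wires w)).
  have g adj := @GateComputes R _ pi m a adj _ _ _ e0 _ _ _ _ _ _ _ pia.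
  have gate_of adj c : c = [:: Gate a adj (wires w)] ->
      circuit_computes pi c (on_qubits e0 (if adj then adjoint U else U)).
    by move=> ->; rewrite -[on_qubits _ _]mul1mx; apply: CircuitCons.
  have gate_unitary adj : on_qubits e0 (if adj then adjoint U else U) \is unitarymx.
    by apply: on_qubits_unitary; case: adj => //; exact: adjoint_unitary.
  case: j i iG Xw0 => [|[|j]] [|[|i]] //= _; rewrite ?onth0n // => Xw.
  + exists 1%:M; split=> // Q; rewrite mul1mx /conf /= (@ctx_at_iter Dia CDia) //.
    by apply: QDownDiaDia; auto.
  + exists (on_qubits e0 (adjoint U)); split=> [||Q].
    * exact: (gate_of true).
    * exact: (gate_unitary true).
    rewrite /conf /= (@ctx_at_iter Dia CDia) //.
    (* The transition wants its size equation in terms of [depth], which equals [wires w] only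
       propositionally; [e0] is transported along [dw]. *)
    have dw := depth_ctx_at Xw; move: (wires w) e0 dw {g gate_of gate_unitary zm}.
    by move=> k e0 dw; case: k / dw e0 => e0; apply: QDownBoxDia; auto.
  + exists (on_qubits e0 U); split=> [||Q].
    * exact: (gate_of false).
    * exact: (gate_unitary false).
    rewrite /conf /= (@ctx_at_iter Box CBox) //.
    have dw := depth_ctx_at Xw; move: (wires w) e0 dw {g gate_of gate_unitary zm}.
    by move=> k e0 dw; case: k / dw e0 => e0; apply: QDownDiaBox; auto.
  + exists 1%:M; split=> // Q; rewrite mul1mx /conf /= (@ctx_at_iter Box CBox) //.
    by apply: QDownBoxBox; auto.
- exists 1%:M; split=> // Q; rewrite mul1mx cats0; move: zE H.
  case: b => /=; rewrite ?onth0n // => -[<-]; case Gi: onth => [X|//] Xw.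
  by apply: (context_down (p := PExch _ _ _ _ q)) Xw; exact: CFExch.
Qed.

End Soundness.

(** * Traversals as runs *)

Section Machine.
Variables (R : realType) (m : nat) (Root : seq formula) (pi : proof R Root).
Local Open Scope ring_scope.
Local Notation conf := (@conf R m).
Local Notation runs := (clos_refl_trans _ (@step R m _ pi)).

Lemma conf_state Gamma (p : proof R Gamma) a x t s Q :
    subproof pi a = Some (existT _ _ p) -> pol Gamma x = Some t ->
    (wires x.2 + size s = m)%N -> unit_vector Q ->
  is_state pi (conf a Gamma x s Q).
Proof.
case: x => i w pia /polE[X Gi Xw] /= sm QQ; rewrite (confE _ _ _ _ Gi).
split=> //=; last by rewrite (depth_ctx_at Xw).
exists X; first by rewrite /formula_at /= pia.
by have [/polar_context_for] := polar_ctx_at Xw.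
Qed.

Lemma subproof_child Gamma (p : proof R Gamma) a b q :
    subproof pi a = Some (existT _ _ p) -> child p b = Some q ->
  subproof pi (rcons a b) = Some (existT _ _ q).
Proof. by move=> /(subproof_rcons b) /= -> ->. Qed.

(** The stack is arbitrary so that the claim for a premise applies with the modalities of a quantum
    rule pushed; the circuit is fixed before the stack. *)
Definition trav_runs Gamma (p : proof R Gamma) a x y c : Prop :=
  subproof pi a = Some (existT _ _ p) -> pol Gamma x = Some false ->
  forall s, (wires x.2 + size s = m)%N ->
  exists G : 'M[R[i]]_(2 ^ m),
    [/\ circuit_computes pi c G, G \is unitarymx
      & forall Q, unit_vector Q ->
          runs (conf a Gamma x s Q) (conf a Gamma y s (G *m Q))].

Definition loop_runs Gamma (p : proof R Gamma) a i b x y c : Prop :=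
  subproof pi a = Some (existT _ _ p) -> (i < size Gamma)%N ->
  pol (premise p b) x = Some false ->
  forall s, (wires x.2 + modalities p + size s = m)%N ->
  exists G : 'M[R[i]]_(2 ^ m),
    [/\ circuit_computes pi c G, G \is unitarymx
      & forall Q, unit_vector Q ->
          runs (conf (rcons a b) (premise p b) x (s ++ pushed p i) Q)
               (conf a Gamma y s (G *m Q))].

Lemma trav_loop_runs Gamma (p : proof R Gamma) a :
  (forall x y c, trav p a x y c -> trav_runs p a x y c) /\
  (forall i b x y c, loop p a i b x y c -> loop_runs p a i b x y c).
Proof.
apply: (trav_loop_ind (P := trav_runs) (P0 := loop_runs)) => {Gamma p a} Ga p a.
- move=> x ax pia xn s sm; exists 1%:M; split=> [||Q QQ]; first exact: CircuitNil.
    by apply/unitarymxP; rewrite trmx1 map_mx1 mulmx1.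
  have [yp _] := trav_pol (TravAx a x ax) xn.
  rewrite mul1mx; apply: rt_step; split.
  + exact: conf_state pia xn sm QQ.
  + exact: conf_state pia yp sm QQ.
  + by exists a, Ga, p; split=> //; exact: step_axiom.
- move=> x y c nax _ IH pia xn s sm; have [un ux] := up_down nax xn.
  have [q qb] := childP un.
  have um : (wires (up p x).2.2 + modalities p + size s = m)%N.
    by rewrite -(wires_down ux).
  have [G [cG GG run]] := IH pia (pol_size xn) un s um; exists G; split=> // Q QQ.
  apply: rt_trans (run Q QQ); apply: rt_step; split.
  + exact: conf_state pia xn sm QQ.
  + apply: (conf_state (subproof_child pia qb) un) => //.
    by rewrite size_cat size_pushed -um; lia.
  + by exists a, Ga, p; split=> //; exact: step_up.
- move=> i b q x y z c qb qt IH yz pia iG xn s sm.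
  have [yp wy] := trav_pol qt xn; have [zp _] := down_up yp yz.
  have zm : (wires z.2 + size s = m)%N by rewrite (wires_down yz) wy.
  have sm' : (wires x.2 + size (s ++ pushed p i) = m)%N.
    by rewrite size_cat size_pushed -sm; lia.
  have [G [cG GG run]] := IH (subproof_child pia qb) xn _ sm'.
  have [G' [cG' GG' stepz]] := step_down pia iG yp yz zm.
  exists (G' *m G); split=> [||Q QQ].
  + exact: circuit_computes_cat.
  + exact: mul_unitarymx.
  apply: rt_trans (run Q QQ) _; rewrite -mulmxA; apply: rt_step; split.
  + apply: (conf_state (subproof_child pia qb) yp); first by rewrite wy.
    exact: unit_vector_unitary.
  + apply: (conf_state pia zp zm); apply: (unit_vector_unitary GG').
    exact: unit_vector_unitary.
  + by exists a, Ga, p.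
- move=> i b q x y z c c' qb qt IH yb _ IHl pia iG xn s sm.
  have [yp wy] := trav_pol qt xn; have [yn _] := bounce yp yb.
  have [q' q'b] := childP yn.
  have sm' : (wires x.2 + size (s ++ pushed p i) = m)%N.
    by rewrite size_cat size_pushed -sm; lia.
  have ym : (wires y.2 + size (s ++ pushed p i) = m)%N by rewrite wy.
  have [G [cG GG run]] := IH (subproof_child pia qb) xn _ sm'.
  have [|G' [cG' GG' run']] := IHl pia iG yn s; first by rewrite wy.
  exists (G' *m G); split=> [||Q QQ].
  + exact: circuit_computes_cat.
  + exact: mul_unitarymx.
  have GQ : unit_vector (G *m Q) by exact: unit_vector_unitary.
  apply: rt_trans (run Q QQ) _; rewrite -mulmxA.
  apply: rt_trans (run' _ GQ); apply: rt_step; split.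
  + exact: (conf_state (subproof_child pia qb) yp).
  + exact: (conf_state (subproof_child pia q'b) yn).
  + by exists a, Ga, p; split=> //; exact: step_bounce.
Qed.

End Machine.

(** * Determinism *)

Section Determinism.
Variables (R : realType) (m : nat).
Local Open Scope ring_scope.
Notation config := (config R m).

(** The junk value is taken when the wires [d, ..., d + n - 1] do not fit. *)
Definition on_wires d n (U : 'M[R[i]]_(2 ^ n)) : 'M[R[i]]_(2 ^ m) :=
  if @eqP _ (d + n + (m - d - n))%N m is ReflectT e then on_qubits e U else 1%:M.

(** [on_wires] takes no equality proof, so registers obtained from different decompositions of [m]
    can be compared. *)
Lemma on_qubitsE d n k (e : (d + n + k = m)%N) (U : 'M[R[i]]_(2 ^ n)) :
  on_qubits e U = on_wires d U.
Proof.
have ek : (m - d - n)%N = k by rewrite -e; lia.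
rewrite /on_wires; case: eqP => [e'|[]]; last by rewrite ek.
by case: k / ek e => e; rewrite (eq_irrelevance e e').
Qed.

(** [enter] and [exit] give successors as functions: the former for a token at a negative atom of
    the conclusion, the latter for one at a positive atom of premise [b]. *)
Definition enter Gamma (p : proof R Gamma) (a : address) (x : config) :=
  let: (j, w) := ((c_occ x).2, path_of (c_ctx x)) in
  if is_axiom p then ((a, (1 - j)%N), w, c_stack x, c_reg x)
  else let: (b, (i, v)) := up p (j, w) in
    ((rcons a b, i), v, c_stack x ++ pushed p j, c_reg x).

(** Through which formula of the conclusion of a quantum rule the token entered
    is read off the top of the stack. *)
Definition entry (s : stack) : nat := if last MBox s is MDia then 0%N else 1%N.

Definition exit_reg Gamma (p : proof R Gamma) (i : nat) (y : pos)
    (Q : 'cV[R[i]]_(2 ^ m)) : 'cV[R[i]]_(2 ^ m) :=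
  match p with
  | PQ _ _ _ U _ _ _ _ =>
      if y.1 == i then Q
      else on_wires (wires y.2) (if i == 1%N then adjoint U else U) *m Q
  | _ => Q
  end.

Definition exit Gamma (p : proof R Gamma) (a : address) (b : bool) (x : config) :=
  let: y := ((c_occ x).2, path_of (c_ctx x)) in
  let: s := c_stack x in
  if down p b y is Some z then
    ((a, z.1), z.2, take (size s - modalities p) s, exit_reg p (entry s) y (c_reg x))
  else ((rcons a (~~ b), y.1), y.2, s, c_reg x).

(** On states this loses nothing: the formula at the occurrence and the path determine the
    context. *)
Definition skeleton (x : config) :=
  (c_occ x, path_of (c_ctx x), c_stack x, c_reg x).

Lemma path_of_iter (g : ctx -> ctx) n C :
    (forall D, path_of (g D) = None :: path_of D) ->
  path_of (iter n g C) = nseq n None ++ path_of C.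
Proof. by move=> gE; elim: n => //= n IH; rewrite gE IH. Qed.

(** As [0 < n], the pushed block is not empty and its modality shows on top. *)
Lemma entry_pushed s n c : (0 < n)%N ->
  entry (s ++ nseq n c) = if c is MDia then 0%N else 1%N.
Proof.
by case: n => // n _; rewrite /entry last_cat -{1}addn1 nseqD cats1 last_rcons.
Qed.

Lemma take_pushed (s : stack) n c : take (size (s ++ nseq n c) - n) (s ++ nseq n c) = s.
Proof. by rewrite size_cat size_nseq addnK take_size_cat. Qed.

Lemma rule_stepE a Gamma (p : proof R Gamma) x y : rule_step a p x y ->
  [/\ (c_occ x).1 = a,
      exists2 X, onth Gamma (c_occ x).2 = Some X & negative (c_ctx x) X
    & skeleton y = enter p a x] \/
  exists b, [/\ (c_occ x).1 = rcons a b,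
      exists2 X, onth (premise p b) (c_occ x).2 = Some X & positive (c_ctx x) X
    & skeleton y = exit p a b x].
Proof.
case=> {Gamma p x y}.
- by move=> A N s Q NA; left; split=> //; [exists A|rewrite /skeleton /= path_of_cdual].
- move=> A N s Q NA; left; split=> //; first by exists (dual A).
  by rewrite /skeleton /= path_of_cdual.
- move=> A G D p q P s Q PA; right; exists false; split=> //; first by exists A.
  by rewrite /skeleton /= path_of_cdual.
- move=> A G D p q P s Q PA; right; exists true; split=> //; first by exists (dual A).
  by rewrite /skeleton /= path_of_cdual.
- move=> G p X b i j N s Q c NX; left; have [Gj Pi ud] := context_formulaP c.
  split=> //; first by exists X.
  rewrite /skeleton /enter /=; have [-> _] := ud (path_of N).
  by case: c => *; rewrite /= cats0.
- move=> G p X b i j P s Q c PX; right; exists b; have [Gj Pi ud] := context_formulaP c.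
  split=> //; first by exists X.
  rewrite /skeleton /exit /=; have [_ ->] := ud (path_of P).
  by case: c => *; rewrite /= subn0 take_size.
- move=> A B G p N s Q NA; left; split=> //.
    by exists (Par A B) => //; case: NA => a0 ->; exists a0.
  by rewrite /skeleton /enter /= cats0.
- move=> A B G p N s Q NA; left; split=> //.
    by exists (Par A B) => //; case: NA => a0 ->; exists a0.
  by rewrite /skeleton /enter /= cats0.
- move=> A B G p P s Q PA; right; exists false; split=> //; first by exists A.
  by rewrite /skeleton /exit /= subn0 take_size.
- move=> A B G p P s Q PA; right; exists false; split=> //; first by exists B.
  by rewrite /skeleton /exit /= subn0 take_size.
- move=> A B G D p q N s Q NA; left; split=> //.
    by exists (Tens A B) => //; case: NA => a0 ->; exists a0.
  by rewrite /skeleton /enter /= cats0.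
- move=> A B G D p q N s Q NA; left; split=> //.
    by exists (Tens A B) => //; case: NA => a0 ->; exists a0.
  by rewrite /skeleton /enter /= cats0.
- move=> A B G D p q P s Q PA; right; exists false; split=> //; first by exists A.
  by rewrite /skeleton /exit /= subn0 take_size.
- move=> A B G D p q P s Q PA; right; exists true; split=> //; first by exists B.
  by rewrite /skeleton /exit /= subn0 take_size.
- move=> n A B U n0 UU e p N s Q NA; left; split=> //.
    exists (iter n Dia A) => //; case: NA => a0 ->; exists a0.
    by elim: n {U n0 UU} => //= n ->.
  by rewrite /skeleton /enter /= path_of_iter // drop_size_cat ?size_nseq.
- move=> n A B U n0 UU e p N s Q NA; left; split=> //.
    exists (iter n Box B) => //; case: NA => a0 ->; exists a0.
    by elim: n {U n0 UU} => //= n ->.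
  by rewrite /skeleton /enter /= path_of_iter // drop_size_cat ?size_nseq.
- move=> n A B U n0 UU e p P s Q PA; right; exists false; split=> //; first by exists A.
  by rewrite /skeleton /exit /= path_of_iter // take_pushed entry_pushed.
- move=> n A B U n0 UU e p P s Q e0 PA; right; exists false.
  split=> //; first by exists A.
  rewrite /skeleton /exit /= path_of_iter // take_pushed entry_pushed //=.
  by rewrite on_qubitsE depth_path.
- move=> n A B U n0 UU e p P s Q PA; right; exists false; split=> //; first by exists B.
  by rewrite /skeleton /exit /= path_of_iter // take_pushed entry_pushed.
- move=> n A B U n0 UU e p P s Q e0 PA; right; exists false.
  split=> //; first by exists B.
  rewrite /skeleton /exit /= path_of_iter // take_pushed entry_pushed //=.
  by rewrite on_qubitsE depth_path.
Qed.

Lemma positive_child Gamma (p : proof R Gamma) b i X C :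
    onth (premise p b) i = Some X -> positive C X ->
  exists q, child p b = Some q.
Proof.
move=> Pi /(polarP true)[XC _].
by apply: (@childP _ _ p b (i, path_of C) true); rewrite /pol /= Pi.
Qed.

(** Polarity fixes the rule that acts: for a negative atom the one concluding the occurrence, for a
    positive atom the one having it in a premise. *)
Lemma step_deterministic Gamma (pi : proof R Gamma) (x y z : config) :
  step pi x y -> step pi x z -> y = z.
Proof.
move=> [_ ys [a [G [p [pia xy]]]]] [_ zs [a' [G' [p' [pia' xz]]]]].
suff: skeleton y = skeleton z.
  case: y z ys zs {xy xz} => [o C s Q] [o' C' s' Q'] [[X oX CX] _ _] [[X' oX' CX'] _ _].
  case=> eo CC' -> ->; move: oX oX' CX CX'; rewrite /= -eo; move=> -> [<-].
  by move=> /context_for_ctx_at <- /context_for_ctx_at <-; rewrite CC'.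
(* An entering and an exiting transition from one state would make the token's atom both negative
   and positive. *)
have mixed (b b0 : address) (d : bool) H H' (q : proof R H) (q' : proof R H') :
    subproof pi b = Some (existT _ _ q) -> subproof pi b0 = Some (existT _ _ q') ->
    b = rcons b0 d ->
    (exists2 X, onth H (c_occ x).2 = Some X & negative (c_ctx x) X) ->
    (exists2 X, onth (premise q' d) (c_occ x).2 = Some X & positive (c_ctx x) X) -> False.
  move=> + pib0 bb0 [X HX XN] [Y HY YP]; have [r rd] := positive_child HY YP.
  rewrite bb0 (subproof_child pib0 rd) => -[HH _]; move: HY; rewrite HH HX => -[XY].
  by have := @polar_inj false true _ _ XN; rewrite XY => /(_ YP).
have [[xa Xn ->]|[b [xa Xp ->]]] := rule_stepE xy;
  have [[xa' X'n ->]|[b' [xa' X'p ->]]] := rule_stepE xz.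
- have aa' : a = a' by rewrite -xa.
  (* [p] and [p'] have types that are only provably equal, so their equality is stated on dependent
     pairs. *)
  have e : existT (proof R) G p = existT (proof R) G' p'.
    by apply: Some_inj; rewrite -pia -pia' aa'.
  by rewrite -aa'; exact: (congr1 (fun P => enter (projT2 P) a x) e).
- by case: (mixed _ _ _ _ _ _ _ pia pia' _ Xn X'p); rewrite -xa.
- by case: (mixed _ _ _ _ _ _ _ pia' pia _ X'n Xp); rewrite -xa'.
- have /rcons_inj[aa' bb'] : rcons a b = rcons a' b' by rewrite -xa.
  have e : existT (proof R) G p = existT (proof R) G' p'.
    by apply: Some_inj; rewrite -pia -pia' aa'.
  by rewrite -aa' -bb'; exact: (congr1 (fun P => exit (projT2 P) a b x) e).
Qed.

(** A positive token is moved only by the rule below its occurrence, and there is none below the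
    root. *)
Lemma root_stuck Gamma (pi : proof R Gamma) (x y : config) :
  (c_occ x).1 = [::] ->
  (exists2 X, onth Gamma (c_occ x).2 = Some X & positive (c_ctx x) X) -> ~ step pi x y.
Proof.
move=> x0 [X GX XP] [_ _ [a [G [p [pia /rule_stepE[[xa [Y GY YN] _]|[b [+ _ _]]]]]]]];
  last by rewrite x0; case: a {pia}.
move: pia GY; rewrite -xa x0 subproof_nil => -[GG _]; rewrite -GG GX => -[XY].
by have := @polar_inj false true _ _ YN; rewrite -XY => /(_ XP).
Qed.

End Determinism.

(** A deterministic run into a stuck point passes through every point that its
    origin reaches, so that point is the only stuck one. *)
Lemma unique_stuck (T : Type) (S : T -> T -> Prop) x y z :
    (forall x y z, S x y -> S x z -> y = z) ->
    (forall u, ~ S y u) -> (forall u, ~ S z u) ->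
    clos_refl_trans _ S x y -> clos_refl_trans _ S x z -> y = z.
Proof.
move=> S_det y_stuck z_stuck xy xz.
move: (clos_rt_rt1n _ _ _ _ xy) (clos_rt_rt1n _ _ _ _ xz) => {xz}xy.
elim: xy y_stuck => {x y} [x x_stuck|x u y xu _ IH y_stuck] xz.
  by case: xz x_stuck => // u v xu _ /(_ u).
apply: IH y_stuck _; case: xz xu z_stuck => [xu /(_ u)//|v w xv vw xu _].
by rewrite (S_det _ _ _ xu xv).
Qed.

(** * The interpretation as a unitary matrix *)

Section Denotation.
Variable R : realType.
Local Open Scope ring_scope.

(** The traversal yields one run to a positive state at the root; such states are stuck, so
    [unique_stuck] rules out any other result. *)
Lemma trav_denotes A (pi : proof R [:: A]) N y c :
    negative N A -> trav pi [::] (0%N, path_of N) y c ->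
  exists G : 'M[R[i]]_(2 ^ depth N),
    [/\ circuit_computes pi c G, G \is unitarymx & denotes pi N G].
Proof.
move=> /(polarP false)[NA Nctx] t; have [yp wy] := trav_pol t NA.
have mN : (wires (path_of N) + @size modality [::] = depth N)%N.
  by rewrite addn0 depth_path.
have [G [cG GG run]] := (trav_loop_runs (depth N) pi pi [::]).1 _ _ _ t
  (subproof_nil pi) NA [::] mN.
exists G; split=> // Q QQ Q'.
have {run} := run Q QQ; rewrite /conf /= Nctx.
(* The conclusion has a single formula, so the exit index is 0. *)
case: y t yp {wy} => j w t /[dup] /pol_size; case: j t => // t _ yp run.
have [wP _] := @polar_ctx_at true A w yp.
split=> [[P PA runP]|->]; last by exists (ctx_at A w).
have stuck P' Q1 : positive P' A ->
    forall u, ~ step pi (Config ([::], 0%N) P' [::] Q1 : config R (depth N)) u.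
  by move=> P'A u; apply: root_stuck => //; exists A.
by have [] := unique_stuck (@step_deterministic _ _ _ pi) (stuck _ _ PA)
  (stuck _ _ wP) runP run.
Qed.

Lemma denotes_unique A (pi : proof R [:: A]) N (G G' : 'M[R[i]]_(2 ^ depth N)) :
  denotes pi N G -> denotes pi N G' -> G = G'.
Proof.
move=> dG dG'; apply: eq_on_unit_vectors => Q QQ.
by apply/(dG' Q QQ)/(dG Q QQ).
Qed.

End Denotation.

(** * The extractor *)

Definition calls (P : program) (k : nat) (v w : data) : Prop :=
  exists2 body, onth P k = Some body & evaluates P v body w.

(** Weakest precondition: [wp P x t K] holds if [t] evaluates at [x] to a value
    satisfying [K]. *)
Fixpoint wp (P : program) (x : data) (t : term) (K : data -> Prop) : Prop :=
  match t with
  | TArg => K x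
  | TLeaf => K Leaf
  | TNode t u => wp P x t (fun v => wp P x u (fun w => K (Node v w)))
  | THd t => wp P x t (fun v => K (data_hd v))
  | TTl t => wp P x t (fun v => K (data_tl v))
  | TIf t u1 u2 =>
      wp P x t (fun v => if v is Node _ _ then wp P x u1 K else wp P x u2 K)
  | TCall k t => wp P x t (fun v => exists2 w, calls P k v w & K w)
  end.

Lemma wp_evaluates P x t K : wp P x t K -> exists2 w, evaluates P x t w & K w.
Proof.
elim: t K => /= [||t IHt u IHu|t IHt|t IHt|t IHt u1 IH1 u2 IH2|k t IHt] K.
- by exists x => //; exact: EvArg.
- by exists Leaf => //; exact: EvLeaf.
- move=> /IHt[v tv /IHu[w uw Kw]].
  by exists (Node v w) => //; exact: EvNode.
- by move=> /IHt[v tv Kv]; exists (data_hd v) => //; exact: EvHd.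
- by move=> /IHt[v tv Kv]; exists (data_tl v) => //; exact: EvTl.
- case/IHt=> -[|v1 v2] tv.
    by case/IH2=> w uw Kw; exists w => //; exact: EvIfLeaf.
  by case/IH1=> w uw Kw; exists w => //; exact: EvIfNode tv uw.
- case/IHt=> v tv [w [body Pk ew] Kw]; exists w => //; exact: EvCall tv Pk ew.
Qed.

Lemma wp_calls P k body v w :
  onth P k = Some body -> wp P v body (eq w) -> calls P k v w.
Proof. by move=> Pk /wp_evaluates[w' ew ->]; exists body. Qed.

Definition TTrue := TNode TLeaf TLeaf.
Definition TSucc t := TNode TLeaf t.
Definition TNot t := TIf t TLeaf TTrue.
Definition TProj k t := THd (iter k TTl t).
(** The [k]-th argument of a node made by [code_node]. *)
Definition TChild k t := THd (iter k TTl (TTl t)).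

(** Dispatches on a unary tag, each [TTl] taking off one successor; tags past the last branch give
    [Leaf], as for exchange in [emission_body]. *)
Fixpoint TSwitch (t : term) (us : seq term) : term :=
  match us with
  | [::] => TLeaf
  | u :: us => TIf t (TSwitch (TTl t) us) u
  end.

Definition fPath := 1.
Definition fCat := 2.
Definition fSize := 3.
Definition fSplit := 4.
Definition fDrop := 5.
Definition fWires := 6.
Definition fExch := 7.
Definition fUp := 8.
Definition fDown := 9.
Definition fPremise := 10.
Definition fEmission := 11.
Definition fTrav := 12.
Definition fLoop := 13.
Definition fExit := 14.
Definition fResume := 15.
Definition fMerge := 16.

Definition TCat t u := TCall fCat (TNode t u).
(** [fSplit] yields [Leaf] or a successor, so its result is both the test and the index in the
    second premise; terms have no local binding, hence the repeated call. *)
Definition TSplit G i w :=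
  TIf (TCall fSplit (TNode G i))
      (TNode TTrue (TNode (TCall fSplit (TNode G i)) w))
      (TNode TLeaf (TNode (TSucc i) w)).

Definition main_body :=
  TTl (TCall fTrav (TNode (THd TArg) (TNode TLeaf
    (TNode TLeaf (TCall fPath (TTl TArg)))))).

Definition path_body :=
  let left k := TNode TTrue (TCall fPath (TChild k TArg)) in
  let right k := TNode (TSucc TTrue) (TCall fPath (TChild k TArg)) in
  let under := TNode TLeaf (TCall fPath (TChild 0 TArg)) in
  TSwitch (THd TArg) [:: TLeaf; left 0; right 1; left 0; right 1; under; under].

Definition cat_body :=
  TIf (THd TArg)
      (TNode (THd (THd TArg)) (TCat (TTl (THd TArg)) (TTl TArg)))
      (TTl TArg).

Definition size_body := TIf TArg (TSucc (TCall fSize (TTl TArg))) TLeaf.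

(** [Leaf] if the index [i] is smaller than the size of [G], and [i - size G + 1]
    otherwise. *)
Definition split_body :=
  let: (G, i) := (THd TArg, TTl TArg) in
  TIf G (TIf i (TCall fSplit (TNode (TTl G) (TTl i))) TLeaf) (TSucc i).

Definition drop_body :=
  TIf (THd TArg) (TCall fDrop (TNode (TTl (THd TArg)) (TTl (TTl TArg)))) (TTl TArg).

Definition wires_body :=
  let rest := TCall fWires (TTl TArg) in
  TIf TArg (TIf (THd TArg) rest (TSucc rest)) TLeaf.

Definition exch_body :=
  let: (G, i) := (THd TArg, TTl TArg) in
  TIf G (TIf i (TSucc (TCall fExch (TNode (TTl G) (TTl i)))) TLeaf)
        (TIf i (TIf (TTl i) i TLeaf) TTrue).

Definition up_body :=
  let: (p, i, w) := (THd TArg, THd (TTl TArg), TTl (TTl TArg)) in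
  let left := TNode TLeaf in
  TSwitch (THd p)
    [:: TLeaf;
        TSplit (TChild 1 p) i w;
        left (TIf i (TNode (TSucc i) w)
                    (TNode (TIf (TTl (THd w)) TTrue TLeaf) (TTl w)));
        TIf i (TSplit (TChild 2 p) (TTl i) w)
              (TNode (TTl (THd w)) (TNode TLeaf (TTl w)));
        left (TNode i (TCall fDrop (TNode (TChild 0 p) w)));
        left (TNode (TCall fExch (TNode (TChild 0 p) i)) w)].

Definition down_body :=
  let: (p, b, j, w) :=
    (THd TArg, THd (TTl TArg), THd (TTl (TTl TArg)), TTl (TTl (TTl TArg))) in
  let some t := TNode t TLeaf in
  let shift G j := TIf b (TCat (TCall fSize G) j) j in
  TSwitch (THd p)
    [:: TLeaf;
        TIf j (some (TNode (shift (TChild 1 p) (TTl j)) w)) TLeaf;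
        some (TIf j (TIf (TTl j) (TNode (TTl j) w)
                                 (TNode TLeaf (TNode (TSucc TTrue) w)))
                    (TNode TLeaf (TNode TTrue w)));
        some (TIf j (TNode (TSucc (shift (TChild 2 p) (TTl j))) w)
                    (TNode TLeaf (TNode (TSucc b) w)));
        some (TNode j (TCat (TChild 0 p) w));
        some (TNode (TCall fExch (TNode (TChild 0 p) j)) w)].

Definition premise_body :=
  let: (p, b) := (THd TArg, TTl TArg) in
  TSwitch (THd p)
    [:: TLeaf; TIf b (TChild 4 p) (TChild 3 p); TChild 3 p;
        TIf b (TChild 5 p) (TChild 4 p); TChild 3 p; TChild 4 p].

Definition emission_body :=
  let: (p, a, i, j, w) :=
    (TProj 0 TArg, TProj 1 TArg, TProj 2 TArg, THd (iter 3 TTl TArg),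
     TTl (iter 3 TTl TArg)) in
  let gate adj :=
    TNode (TNode TLeaf (TNode a (TNode adj (TNode (TCall fWires w) TLeaf)))) TLeaf in
  TSwitch (THd p)
    [:: TLeaf; TLeaf; TLeaf; TLeaf;
        TIf i (TIf j TLeaf (gate TTrue)) (TIf j (gate TLeaf) TLeaf)].

Definition trav_body :=
  let: (p, a, i, w) :=
    (THd TArg, THd (TTl TArg), THd (TTl (TTl TArg)), TTl (TTl (TTl TArg))) in
  TIf (THd p)
    (TCall fLoop (TNode p (TNode a (TNode i (TCall fUp (TNode p (TNode i w)))))))
    (TNode (TNode (TNot i) w) TLeaf).

(** One round of the loop is spread over [fLoop], [fExit], [fResume] and [fMerge], because a result
    used several times has to be passed as the argument of a further function. *)
Definition loop_body :=
  let: (p, a, i, b, x) :=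
    (TProj 0 TArg, TProj 1 TArg, TProj 2 TArg, THd (iter 3 TTl TArg),
     TTl (iter 3 TTl TArg)) in
  TCall fExit
    (TNode (TCall fTrav (TNode (TCall fPremise (TNode p b))
                       (TNode (TCat a (TNode b TLeaf)) x)))
           (TNode p (TNode a (TNode i b)))).

Definition exit_body :=
  let: (y, p, b) := (THd (THd TArg), THd (TTl TArg), TTl (TTl (TTl (TTl TArg)))) in
  TCall fResume (TNode (TCall fDown (TNode p (TNode b y))) TArg).

Definition resume_body :=
  let: (z, y, c) :=
    (THd TArg, THd (THd (TTl TArg)), TTl (THd (TTl TArg))) in
  let e := TTl (TTl TArg) in
  let: (p, a, i, b) := (TProj 0 e, TProj 1 e, TProj 2 e, TTl (TTl (TTl e))) in
  TIf z
    (TNode (THd z) (TCat c (TCall fEmission (TNode p (TNode a (TNode i y))))))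
    (TCall fMerge (TNode c
      (TCall fLoop (TNode p (TNode a (TNode i (TNode (TNot b) y))))))).

Definition merge_body :=
  TNode (THd (TTl TArg)) (TCat (THd TArg) (TTl (TTl TArg))).

Definition extractor : program :=
  [:: main_body; path_body; cat_body; size_body; split_body; drop_body;
      wires_body; exch_body; up_body; down_body; premise_body; emission_body;
      trav_body; loop_body; exit_body; resume_body; merge_body].

(** The tail of the code of [Some b] is the code of [b], so [up_body] reads the chosen side as
    [TTl (THd w)]. *)
Definition code_dir (d : option bool) : data :=
  if d is Some b then Node Leaf (code_bool b) else Leaf.
Definition code_path : path -> data := code_seq code_dir.
Definition code_pos (x : pos) : data := Node (code_nat x.1) (code_path x.2).
Definition code_address : address -> data := code_seq code_bool.

Local Notation computes := (calls extractor).

Lemma computes_path C : computes fPath (code_ctx C) (code_path (path_of C)).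
Proof.
elim: C => [|C IH A|A C IH|C IH A|A C IH|C IH|C IH];
  apply: wp_calls => //=; eauto.
Qed.

Lemma computes_cat (T : Type) (f : T -> data) s t :
  computes fCat (Node (code_seq f s) (code_seq f t)) (code_seq f (s ++ t)).
Proof. by elim: s => [|x s IH]; apply: wp_calls => //=; eauto. Qed.

(** A unary number is the code of a list of leaves, so [fCat] also adds. *)
Lemma code_nat_seq n : code_nat n = code_seq id (nseq n Leaf).
Proof. by elim: n => //= n ->. Qed.

Lemma computes_add m n :
  computes fCat (Node (code_nat m) (code_nat n)) (code_nat (m + n)).
Proof. by rewrite !code_nat_seq nseqD; exact: computes_cat. Qed.

Lemma computes_size G : computes fSize (code_sequent G) (code_nat (size G)).
Proof. by elim: G => [|A G IH]; apply: wp_calls => //=; eauto. Qed.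

Lemma computes_split G i : computes fSplit (Node (code_sequent G) (code_nat i))
  (if i < size G then Leaf else code_nat (i - size G).+1).
Proof.
elim: G i => [|A G IH] [|i]; apply: wp_calls => //=.
by eexists; first exact: IH.
Qed.

Lemma computes_drop n w :
  computes fDrop (Node (code_nat n) (code_path w)) (code_path (drop n w)).
Proof.
elim: n w => [|n IH] w; apply: wp_calls => //=; first by rewrite drop0.
by case: w => [|d w] /=; eexists; try exact: (IH [::]); try exact: IH.
Qed.

Lemma computes_wires w : computes fWires (code_path w) (code_nat (wires w)).
Proof. by elim: w => [|[b|] w IH]; apply: wp_calls => //=; eauto. Qed.

Lemma computes_exch G i : computes fExch (Node (code_sequent G) (code_nat i))
  (code_nat (exch_index (size G) i)).
Proof.
elim: G i => [|A G IH] [|i]; apply: wp_calls => //=; first by case: i => [|i] /=.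
eexists; first exact: IH; rewrite /exch_index !eqSS.
by case: eqP => // _; case: eqP.
Qed.

(** * Correctness of the extractor *)

Section ProgramRuns.
Variable R : realType.
Local Notation computes := (calls extractor).

Lemma computes_premise Gamma (p : proof R Gamma) b q : child p b = Some q ->
  computes fPremise (Node (code_proof p) (code_bool b)) (code_proof q).
Proof.
case: p q => [//|A G D r r'|A B G r|A B G D r r'|n A B U n0 UU e r|G A B D r];
  by case: b => //= _ [<-]; apply: wp_calls.
Qed.

Lemma computes_up Gamma (p : proof R Gamma) x :
    ~~ is_axiom p -> pol Gamma x = Some false ->
  computes fUp (Node (code_proof p) (code_pos x))
    (Node (code_bool (up p x).1) (code_pos (up p x).2)).
Proof.
case: x => i w.
case: p => [//|A G D q r|A B G q|A B G D q r|n A B U n0 UU e q|G A B D q] _;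
  rewrite /pol /= => xn; apply: wp_calls => //=.
- exists (if i < size G then Leaf else code_nat (i - size G).+1).
    exact: computes_split.
  rewrite /split_index; case: ltnP => //= iG.
  exists (code_nat (i - size G).+1) => //.
  by have := computes_split G i; rewrite ltnNge iG.
- by case: i xn => [|i] //=; case: w => [|[[]|] w].
- case: i xn => [|i] /=; first by case: w => [|[[]|] w].
  move=> _; exists (if i < size G then Leaf else code_nat (i - size G).+1).
    exact: computes_split.
  rewrite /split_index; case: ltnP => //= iG.
  exists (code_nat (i - size G).+1) => //.
  by have := computes_split G i; rewrite ltnNge iG.
- by eexists; first exact: computes_drop.
- by eexists; first exact: computes_exch.
Qed.

Definition code_exit (z : option pos) : data :=
  if z is Some z then Node (code_pos z) Leaf else Leaf.

Lemma computes_down Gamma (p : proof R Gamma) b y : ~~ is_axiom p ->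
  computes fDown (Node (code_proof p) (Node (code_bool b) (code_pos y)))
    (code_exit (down p b y)).
Proof.
case: y => j w.
case: p => [//|A G D q r|A B G q|A B G D q r|n A B U n0 UU e q|G A B D q] _;
  apply: wp_calls => //=.
- case: j => //= j; case: b => //=.
  by eexists; [exact: computes_size|eexists; first exact: computes_add].
- by case: j => [|[|j]].
- case: j => [|j] /=; first by case: b.
  case: b => //=.
  by eexists; [exact: computes_size|eexists; first exact: computes_add].
- eexists; last by [].
  (* [code_dir None] is [Leaf], so the code of [n] is also the code of a path through [n]
     modalities. *)
  suff -> : code_nat n = code_path (nseq n None) by exact: computes_cat.
  by elim: (n) => //= k ->.
- by eexists; first exact: computes_exch.
Qed.

(** The program compares the two indices by zero tests; at a quantum rule the bounds confine both to
    0 and 1, where this is correct. *)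
Lemma computes_emission Gamma (p : proof R Gamma) a b i y :
    ~~ is_axiom p -> i < size Gamma -> y.1 < size (premise p b) ->
  computes fEmission
    (Node (code_proof p) (Node (code_address a) (Node (code_nat i) (code_pos y))))
    (code_circuit (emission p a i y)).
Proof.
case: y => j w.
case: p => [//|A G D q r|A B G q|A B G D q r|n A B U n0 UU e q|G A B D q] _;
  move=> ip jp; apply: wp_calls => //=.
by case: b jp => //=; case: i j ip => [|[|i]] [|[|j]] //= _ _;
  (eexists; first exact: computes_wires).
Qed.

Definition computes_trav Gamma (p : proof R Gamma) a x y c : Prop :=
  pol Gamma x = Some false ->
  computes fTrav
    (Node (code_proof p) (Node (code_address a) (code_pos x)))
    (Node (code_pos y) (code_circuit c)).

Definition computes_loop Gamma (p : proof R Gamma) a i b x y c : Prop :=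
  i < size Gamma -> pol (premise p b) x = Some false ->
  computes fLoop
    (Node (code_proof p) (Node (code_address a) (Node (code_nat i)
       (Node (code_bool b) (code_pos x)))))
    (Node (code_pos y) (code_circuit c)).

(** The induction is on the traversal, not on the proof, since the program visits a premise of a cut
    as often as the token bounces into it. *)
Lemma computes_trav_loop Gamma (p : proof R Gamma) a :
  (forall x y c, trav p a x y c -> computes_trav p a x y c) /\
  (forall i b x y c, loop p a i b x y c -> computes_loop p a i b x y c).
Proof.
apply: (trav_loop_ind (P := computes_trav) (P0 := computes_loop)) => {Gamma p a} Ga p a.
- move=> [i w] ax xn; have := pol_size xn; case: p ax xn => // A _ _.
  by case: i => [|[|i]] //= _; apply: wp_calls.
- move=> [i w] y c nax _ IH xn; have [un _] := up_down nax xn.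
  (* A rule other than the axiom has a nonzero tag, so [trav_body] takes the branch of the loop. *)
  have tag : exists t v, code_proof p = Node (Node Leaf t) v.
    by case: p nax {IH xn un} => //= *; do 2!eexists.
  have := computes_up nax xn; have := IH (pol_size xn) un.
  case: tag => t [v ->] loop_ok up_ok; apply: wp_calls => //=.
  by eexists; [exact: up_ok|eexists; first exact: loop_ok].
- move=> i b q x y z c qb qt IH yz iG xn; have nax := child_nonaxiom qb.
  have [yp _] := trav_pol qt xn.
  apply: wp_calls => //=.
  exists (code_proof q); first exact: computes_premise.
  eexists; first exact: (computes_cat code_bool a [:: b]).
  rewrite cats1; eexists; first exact: (IH xn).
  eexists; last by [].
  apply: wp_calls => //=.
  eexists; first exact: computes_down.
  eexists; last by [].
  rewrite yz; apply: wp_calls => //=.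
  eexists; first exact: (computes_emission a nax iG (pol_size yp)).
  by (eexists; first exact: (computes_cat code_gate)).
- move=> i b q x y z c c' qb qt IH yz _ IHl iG xn; have nax := child_nonaxiom qb.
  have [yp _] := trav_pol qt xn; have [yn _] := bounce yp yz.
  apply: wp_calls => //=.
  exists (code_proof q); first exact: computes_premise.
  eexists; first exact: (computes_cat code_bool a [:: b]).
  rewrite cats1; eexists; first exact: (IH xn).
  eexists; last by [].
  apply: wp_calls => //=.
  eexists; first exact: computes_down.
  eexists; last by [].
  rewrite yz; apply: wp_calls => //=.
  have l := IHl iG yn.
  (* [TNot] has to compute on the code of [b]. *)
  case: b {IH IHl qb q qt xn yz yp yn} l => /= l; (eexists; first exact: l);
  (eexists; last by []); apply: wp_calls => //=;
  by (eexists; first exact: (computes_cat code_gate)).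
Qed.

End ProgramRuns.

Local Open Scope ring_scope.

Theorem theorem1 (R : realType) :
  (forall (A : formula) (pi : proof R [:: A]) (N : ctx), negative N A ->
     exists M : 'M[R[i]]_(2 ^ depth N),
       unique (denotes pi N) M /\ M \is unitarymx)
  /\
  (exists extractor : program,
     forall (A : formula) (pi : proof R [:: A]) (N : ctx), negative N A ->
       exists (c : circuit) (M : 'M[R[i]]_(2 ^ depth N)),
         [/\ program_outputs extractor
               (Node (code_proof pi) (code_ctx N)) (code_circuit c),
             circuit_computes pi c M
           & denotes pi N M]).
Proof.
have entry_pol A N : negative N A -> pol [:: A] (0%N, path_of N) = Some false.
  by case/(polarP false).
split=> [A pi N NA|].
  have [y [c t]] := (trav_bijective pi).1 [::] _ (entry_pol _ _ NA).
  have [M [_ MM dM]] := trav_denotes NA t.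
  by exists M; split=> //; split=> // M'; exact: denotes_unique dM.
exists extractor => A pi N NA.
have [y [c t]] := (trav_bijective pi).1 [::] _ (entry_pol _ _ NA).
have [M [cM _ dM]] := trav_denotes NA t; exists c, M; split=> //.
suff [_ [<-] run] : calls extractor 0 (Node (code_proof pi) (code_ctx N))
    (code_circuit c).
  by apply: EvCall run => //; exact: EvArg.
apply: wp_calls => //=; exists (code_path (path_of N)); first exact: computes_path.
by eexists; first exact: ((computes_trav_loop pi [::]).1 _ _ _ t (entry_pol _ _ NA)).
Qed.
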